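(* Let $r\in\mathbb{N}$ and let $\tau\colon\mathbb{N}\to\{1,\ldots,r\}$ be a type map. For each type $\theta\in\{1,\ldots,r\}$ let $w_\theta\ge 0$ be a weight and $F_\theta$ an absolutely continuous distribution on $\mathbb{R}$ with density $f_\theta$. Let $\lambda_1,\lambda_2,\ldots$ be mutually independent random variables such that $\lambda_j$ has density $f_{\tau(j)}$, and give representative $j$ the weight $w_j=w_{\tau(j)}$. For $m\in\mathbb{N}$ let $\beta_\theta(m)=|\{k\in\{1,\ldots,m\}:\tau(k)=\theta\}|/m$, and suppose there exist $\beta>0$ and $m^0\in\mathbb{N}$ with $\beta_\theta(m)\ge\beta$ for all $\theta$ and all $m\ge m^0$. Suppose every $F_\theta$ has the same median $\mathrm{M}$, $f_\theta(\mathrm{M})>0$, and there are $\varepsilon_1>0$ and $c\ge 0$ such that $|f_\theta(x)-f_\theta(\mathrm{M})|\le c(x-\mathrm{M})^2$ for all $x\in[\mathrm{M}-\varepsilon_1,\mathrm{M}+\varepsilon_1]$ and all $\theta$. Then for all $i,j\in\mathbb{N}$ with $w_j>0$, $$\lim_{m\to\infty}\frac{\pi_i(\mathcal{R}^m)}{\pi_j(\mathcal{R}^m)}=\frac{w_i\,f_{\tau(i)}(\mathrm{M})}{w_j\,f_{\tau(j)}(\mathrm{M})}.$$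
   Context: For each $m$, the assembly $\mathcal{R}^m$ consists of representatives $1,\ldots,m$ with ideal points $\lambda_1,\ldots,\lambda_m$ and weights $w_1,\ldots,w_m$, and uses quota $q^m=\tfrac12\sum_{j=1}^m w_j$. Almost surely the $\lambda_j$ are distinct; let $k{:}m$ denote the (random) index of the representative with the $k$-th smallest ideal point among $\lambda_1,\ldots,\lambda_m$, and $w_{k:m}$ its weight. The pivotal position is $P=\min\{j\in\{1,\ldots,m\}:\sum_{k=1}^j w_{k:m}>q^m\}$, and the pivot probability of representative $i$ is $\pi_i(\mathcal{R}^m)=\Pr(P{:}m=i)$, i.e. the probability that $\lambda_i$ is the weighted median (the outcome) of $\mathcal{R}^m$. *)

(* Defs.v *)
From HB Require Import structures.
From mathcomp Require Import all_boot all_order all_algebra.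
From mathcomp Require Import all_classical all_reals all_analysis.
Set Implicit Arguments. Unset Strict Implicit. Unset Printing Implicit Defensive.
Import Order.TTheory GRing.Theory Num.Theory.
Import numFieldNormedType.Exports.
Local Open Scope classical_set_scope.
Local Open Scope ring_scope.

Definition mutually_independent d (Omega : measurableType d) (R : realType)
  (P : probability Omega R) (X : nat -> {RV P >-> R}) : Prop :=
  forall (J : seq nat) (A : nat -> set R),
    uniq J -> (forall j, measurable (A j)) ->
    P (\big[setI/setT]_(j <- J) (X j @^-1` A j)) =
    (\prod_(j <- J) P (X j @^-1` A j))%E.

Definition has_density d (Omega : measurableType d) (R : realType)
  (P : probability Omega R) (X : {RV P >-> R}) (f : R -> R) : Prop :=
  forall A : set R, measurable A ->
    P (X @^-1` A) = (\int[lebesgue_measure]_(x in A) (f x)%:E)%E.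

(* Pointwise event "representative i is pivotal (lambda_i is the weighted
   median) in the assembly of representatives 0,...,m-1 with weights wt".
   Under the a.s. distinctness of the ideal points, this is exactly the
   event P:m = i of the paper: the weight strictly to the left of lambda_i
   does not exceed the quota, while the weight up to and including
   lambda_i exceeds it. *)
Definition pivot_event (T : Type) (R : realType) (lam : nat -> T -> R)
  (wt : nat -> R) (m i : nat) : set T :=
  [set om | (i < m)%N /\
     let q := (\sum_(j < m) wt j) / 2 in
     (\sum_(k < m | lam k om < lam i om) wt k <= q) /\
     (q < \sum_(k < m | lam k om <= lam i om) wt k)].

Definition pivot_prob d (Omega : measurableType d) (R : realType)
  (P : probability Omega R) (lam : nat -> {RV P >-> R}) (wt : nat -> R)
  (m i : nat) : R :=
  fine (P (pivot_event (fun k => (lam k : Omega -> R)) wt m i)).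

Definition type_share (r : nat) (tau : nat -> 'I_r) (theta : 'I_r) (m : nat)
  (R : realType) : R :=
  (#|[set k : 'I_m | tau k == theta]|%:R) / m%:R.

(* Main.v *)
Require Import Defs.
From HB Require Import structures.
From mathcomp Require Import all_boot all_order all_algebra.
From mathcomp Require Import all_classical all_reals all_analysis.
From mathcomp Require Import measurable_realfun perm ring lra.

(* Let V_i be the total weight to the left of lambda_i, so that i is pivotal iff
   q - w_i < V_i <= q.  Moving one representative of type theta from the far
   right to the far left of M has the same effect on the others as lowering the
   quota by w_theta, and a single representative is almost uncorrelated with any
   given event (Bessel's inequality); so the probability that the pivot has type
   theta changes by o(1) when q is shifted by w_theta, and by exchangeability
   pi_i changes by o(1/m).  Summing over K shifts telescopes:
     K pi_i = P(q - w_i < V_i <= q + (K-1) w_i) + o(1/m)   for every fixed K.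
   A window event {q < V_i <= q + L} says that lambda_i falls into a random
   interval determined by the other representatives and located near M, so for i
   and j these probabilities are in the ratio f_i(M) : f_j(M), up to boundary
   and tail errors O(1/m) whose constants do not depend on L.  Taking K w_i and
   K' w_j close to a large L gives the ratio w_i f_i(M) : w_j f_j(M); neither a
   local limit theorem nor the arithmetic of the weights enters. *)

Set Implicit Arguments.
Unset Strict Implicit.
Unset Printing Implicit Defensive.
Import Order.TTheory GRing.Theory Num.Theory.
Import numFieldNormedType.Exports.
Local Open Scope classical_set_scope.
Local Open Scope ring_scope.

(** Pivot probabilities are of order [1/m], so errors of order [o(1/m)] are required, while the only
    concentration at hand is Chebyshev's bound [O(1/m)]. Two devices bridge the gap. In the quota
    shift the exceptional events need only have probability [o(1)]: the shift is estimated for a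
    whole type class, and the missing factor [1/m] comes from dividing by the class size, which is
    at least [beta * m]. In the window comparison tails of order [1/m] are accepted and later
    divided by the window length. No pivot event is independent of the position of a single member,
    but its covariances with the positions of a large class are small on average. Two pivot events
    are therefore compared through a common average over the class, never directly. Closeness of the
    rescaled [m * pi_i] and [m * pi_j] yields a ratio only if they stay away from 0. This holds
    because somebody is always pivotal, so the pivot probabilities sum to at least 1. *)

Definition rect {R : realType} {m : nat} (H : 'I_m -> set R) : set (m.-tuple R) :=
  [set x | forall k, H k (tnth x k)].

Definition indep_family d (Omega : measurableType d) (R : realType)
    (P : probability Omega R) (m : nat) (X : 'I_m -> {RV P >-> R}) : Prop :=
  forall H : 'I_m -> set R, (forall k, measurable (H k)) ->
    P [set om | forall k, H k (X k om)] = (\prod_k P (X k @^-1` H k))%E.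

(** * Joint laws of independent families *)

Section tuple_law.
Context {R : realType} {m : nat}.

Lemma measurable_rect (H : 'I_m -> set R) :
  (forall k, measurable (H k)) -> measurable (rect H).
Proof.
move=> mH; rewrite (_ : rect H = \bigcap_k ((@tnth _ R)^~ k @^-1` H k)).
  apply: fin_bigcap_measurable => // k _; rewrite -[X in measurable X]setTI.
  exact: measurable_tnth.
by apply/seteqP; split=> x /= Hx k; [move=> _; exact: Hx|exact: (Hx k)].
Qed.

(** Boxes are stable under intersection and contain the whole space. They generate the product
    sigma-algebra, since a cylinder over one coordinate is a box with all other sides full; so the
    uniqueness theorem for measures applies. *)
Lemma measure_tuple_unique (mu nu : {measure set (m.-tuple R) -> \bar R}) :
  (mu setT < +oo)%E ->
  (forall H : 'I_m -> set R, (forall k, measurable (H k)) ->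
     mu (rect H) = nu (rect H)) ->
  forall B, measurable B -> mu B = nu B.
Proof.
move=> muoo munu B mB.
pose G : set (set (m.-tuple R)) :=
  [set rect H | H in [set H | forall k, measurable (H k)]].
have rectT : rect (fun=> setT) = setT :> set (m.-tuple R).
  by apply/seteqP; split.
apply: (measure_unique G (fun=> setT)) => //.
- apply/seteqP; split.
    apply: smallest_sub; first exact: smallest_sigma_algebra.
    move=> A; rewrite -bigcup_seq/= => -[k _ [C mC <-]].
    apply: sub_sigma_algebra; exists (fun j => if j == k then C else setT).
      by move=> j /=; case: ifP.
    apply/seteqP; split=> x /=; last first.
      by case=> _ Cx j; case: eqP => // ->.
    by move=> /(_ k); rewrite eqxx.
  apply: smallest_sub; first exact: sigma_algebra_measurable.
  by move=> A [H mH <-]; exact: measurable_rect.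
- move=> _ _ [H mH <-] [K mK <-]; exists (fun k => H k `&` K k).
    by move=> k; exact: measurableI.
  by apply/seteqP; split=> x /=; [move=> HK; split=> k; have [] :=
      HK k|case=> Hx Kx k; split].
- by move=> _; exists (fun=> setT).
- by apply/seteqP; split => // x _; exists 0%N.
- by move=> _ [H mH <-]; exact: munu.
Qed.

Context {d} {Omega : measurableType d} {P : probability Omega R}.

Definition rtuple (X : 'I_m -> {RV P >-> R}) (om : Omega) : m.-tuple R :=
  [tuple X k om | k < m].

Lemma measurable_rtuple X : measurable_fun setT (rtuple X).
Proof.
apply/measurable_fun_tnthP => k.
rewrite (_ : _ \o _ = X k); first exact: measurable_funPT.
by apply/funext => om /=; rewrite tnth_mktuple.
Qed.

HB.instance Definition _ X :=
  isMeasurableFun.Build _ _ _ _ (rtuple X) (measurable_rtuple X).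

Lemma rtuple_rect X H :
  rtuple X @^-1` rect H = [set om | forall k, H k (X k om)].
Proof.
by apply/seteqP; split=> om /= HX k; have := HX k; rewrite tnth_mktuple.
Qed.

(** Independence fixes the joint law on boxes from the marginals, hence everywhere. This is what
    allows two representatives of one type to be exchanged. *)
Lemma indep_law_eq X Y : indep_family X -> indep_family Y ->
  (forall k A, measurable A -> P (X k @^-1` A) = P (Y k @^-1` A)) ->
  forall B, measurable B -> P (rtuple X @^-1` B) = P (rtuple Y @^-1` B).
Proof.
move=> iX iY XY B mB.
apply: (measure_tuple_unique (mu := distribution P (rtuple X))
  (nu := distribution P (rtuple Y))) => //.
  by rewrite [X in (X < _)%E]probability_setT ltry.
move=> H mH; rewrite /= /distribution /pushforward !rtuple_rect iX// iY//.
by apply: eq_bigr => k _; exact: XY.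
Qed.

(* The family without the members of [D], whose values become the constant 0. *)
Definition erase (D : {set 'I_m}) (X : 'I_m -> {RV P >-> R}) (k : 'I_m) :
  {RV P >-> R} := if k \in D then (cst 0 : {mfun Omega >-> R}) else X k.

Lemma erase_rect X D H :
  rtuple (erase D X) @^-1` rect H = [set _ | forall k, k \in D -> H k 0] `&`
     [set om | forall k, (if k \in D then setT else H k) (X k om)].
Proof.
rewrite rtuple_rect; apply/seteqP; split=> om /=.
  move=> HX; split=> k; first by move=> kD; have := HX k; rewrite /erase kD.
  by have := HX k; rewrite /erase; case: ifP.
move=> [H0 HX] k; rewrite /erase; case: ifP => kD; first exact: H0.
by have := HX k; rewrite kD.
Qed.

Lemma indep_erase (X : 'I_m -> {RV P >-> R}) (D : {set 'I_m}) (i : 'I_m) :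
    indep_family X -> i \in D ->
  forall B A, measurable B -> measurable A ->
  P (rtuple (erase D X) @^-1` B `&` X i @^-1` A) =
  (P (rtuple (erase D X) @^-1` B) * P (X i @^-1` A))%E.
Proof.
move=> iX iD B A mB mA.
have mXA : measurable (X i @^-1` A) by exact: measurable_funPTI.
have a0 : 0 <= fine (P (X i @^-1` A)) by exact: fine_ge0.
have Pfin : P (X i @^-1` A) \is a fin_num by exact: fin_num_measure.
pose mu := pushforward (mrestr P mXA) (rtuple (erase D X)).
pose nu := pushforward (mscale (NngNum a0) P) (rtuple (erase D X)).
have -> : P (rtuple (erase D X) @^-1` B `&` X i @^-1` A) = mu B by [].
rewrite muleC -[in RHS](fineK Pfin).
have -> : ((fine (P (X i @^-1` A)))%:E * P (rtuple (erase D X) @^-1` B))%E = nu B by [].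
apply: measure_tuple_unique => //.
  rewrite [X in (X < _)%E](_ : _ = P (X i @^-1` A)); last first.
    by rewrite /mu/= /pushforward /mrestr; congr (P _); rewrite ?preimage_setT ?setTI.
  by rewrite ltey_eq Pfin.
move=> H mH.
change (P (rtuple (erase D X) @^-1` rect H `&` X i @^-1` A) =
  ((fine (P (X i @^-1` A)))%:E * P (rtuple (erase D X) @^-1` rect H))%E).
rewrite erase_rect.
(* Erased coordinates equal 0, so a box without 0 on some erased side is missed and both measures
   vanish on it. *)
have [H0|/asboolPn H0] := pselect (forall k, k \in D -> H k 0); last first.
  rewrite (_ : [set _ | _] = set0) ?set0I ?measure0 ?mule0//.
  by apply/seteqP; split => // om /= H0'; exfalso; move/asboolP: H0; apply.
rewrite (_ : [set _ | _] = setT) ?setTI; last by apply/seteqP; split.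
rewrite fineK//.
(* The sides are [A'] at [i], the full line at the other erased indices and [H] elsewhere. Taking
   [A'] to be [setT] and then [A] leaves the same product over [k != i]. *)
pose K A' k := if k == i then A' else if k \in D then setT else H k.
have mK A' : measurable A' -> forall k, measurable (K A' k).
  by move=> mA' k; rewrite /K; case: ifP => // _; case: ifP.
have PK A' : measurable A' ->
    P [set om | forall k, K A' k (X k om)] = (P (X i @^-1` A') *
      \prod_(k | k != i) P (X k @^-1` K setT k))%E.
  move=> mA'; rewrite iX; last exact: mK.
  rewrite (bigD1 i)//=; congr (_ * _)%E; first by rewrite /K eqxx.
  by apply: eq_bigr => k ki; rewrite /K (negbTE ki).
have -> : [set om | forall k, (if k \in D then setT else H k) (X k om)] =
    [set om | forall k, K setT k (X k om)].
  apply/seteqP; split=> om /= HX k; have := HX k; rewrite /K.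
    by case: eqP.
  by case: eqP => // ->; rewrite iD.
have -> : [set om | forall k, K setT k (X k om)] `&` X i @^-1` A =
    [set om | forall k, K A k (X k om)].
  apply/seteqP; split=> om /=.
    by move=> [HX XA] k; have := HX k; rewrite /K; case: eqP => // ->.
  move=> HX; split; last by have := HX i; rewrite /K eqxx.
  by move=> k; have := HX k; rewrite /K; case: eqP.
by rewrite PK// PK// preimage_setT probability_setT mul1e.
Qed.

(** Fubini form of independence: the erased tuple can be frozen while [X i] alone is integrated over
    the section. *)
Lemma indep_erase_prod (X : 'I_m -> {RV P >->
    R}) (D : {set 'I_m}) (i : 'I_m) : indep_family X -> i \in D ->
  forall E : set (m.-tuple R * R), measurable E ->
  P [set om | E (rtuple (erase D X) om, X i om)] =
  (\int[distribution P (rtuple (erase D X))]_x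
     distribution P (X i) (xsection E x))%E.
Proof.
move=> iX iD E mE.
pose f om := (rtuple (erase D X) om, X i om).
have mf : measurable_fun setT f.
  by apply/measurable_fun_pairP; split; exact: measurable_funPT.
pose F : {mfun Omega >-> (m.-tuple R * R)%type} :=
  HB.pack f (isMeasurableFun.Build _ _ _ _ f mf).
have mu_unique := @product_measure_unique _ _ _ _ _
  (distribution P (rtuple (erase D X))) (distribution P (X i)) (distribution P F).
apply/esym/(mu_unique _ E mE) => A B mA mB.
exact: (indep_erase iX iD).
Qed.

End tuple_law.

(** * Real-valued probabilities and Bessel's inequality *)

Section real_probability.
Context d (Omega : measurableType d) (R : realType) (P : probability Omega R).

Definition fprob (A : set Omega) : R := fine (P A).

Local Notation pr := fprob.

Lemma prE A : measurable A -> P A = (pr A)%:E.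
Proof. by move=> mA; rewrite fineK// fin_num_measure. Qed.

Lemma pr_ge0 A : 0 <= pr A.
Proof. exact: fine_ge0. Qed.

Lemma pr_le1 A : measurable A -> pr A <= 1.
Proof. by move=> mA; rewrite -lee_fin -prE// probability_le1. Qed.

Lemma pr_setT : pr setT = 1.
Proof. by rewrite /fprob probability_setT. Qed.

Lemma le_pr A B : measurable A -> measurable B -> A `<=` B -> pr A <= pr B.
Proof. by move=> mA mB AB; rewrite -lee_fin -!prE// le_measure ?inE. Qed.

Lemma prU_le A B : measurable A -> measurable B -> pr (A `|` B) <= pr A + pr B.
Proof.
move=> mA mB; rewrite -lee_fin EFinD -!prE//; last exact: measurableU.
exact: measureU2.
Qed.

Lemma pr_le_setU A B C : measurable A -> measurable B -> measurable C ->
  A `<=` B `|` C -> pr A <= pr B + pr C.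
Proof.
move=> mA mB mC ABC; apply: le_trans (prU_le mB mC).
by apply: le_pr => //; exact: measurableU.
Qed.

Lemma pr_setID A B : measurable A -> measurable B ->
  pr A = pr (A `&` B) + pr (A `\` B).
Proof.
move=> mA mB; apply: EFin_inj; rewrite EFinD -!prE//; last 2 first.
- exact: measurableD.
- exact: measurableI.
by rewrite addeC (measureDI P mA mB).
Qed.

Lemma pr_setIr A N : measurable A -> measurable N -> pr N = 1 ->
  pr (A `&` N) = pr A.
Proof.
move=> mA mN N1; rewrite (pr_setID mA mN).
suff -> : pr (A `\` N) = 0 by rewrite addr0.
apply/eqP; rewrite eq_le pr_ge0 andbT.
have : pr (A `\` N) <= pr (~` N).
  by apply: le_pr => [||x []//]; [exact: measurableD|exact: measurableC].
move/le_trans; apply; rewrite -lee_fin -prE; last exact: measurableC.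
by rewrite probability_setC// prE// N1 subee.
Qed.

(** A class of integrable functions stable under sums and products, so that squares can be expanded
    under the integral. *)
Definition bounded_measurable (f : Omega -> R) :=
  measurable_fun setT f /\ exists C, forall x, `|f x| <= C.

Lemma bm_integrable f : bounded_measurable f ->
  P.-integrable setT (EFin \o f).
Proof.
move=> [mf [C fC]]; apply: measurable_bounded_integrable => //.
  by rewrite [X in (X < _)%E]probability_setT ltry.
exists C; split; first exact: num_real.
by move=> M CM x _; exact: le_trans (fC x) (ltW CM).
Qed.

Lemma bm_cst c : bounded_measurable (fun=> c).
Proof. by split => //; exists `|c|. Qed.

Lemma bm_indic A : measurable A -> bounded_measurable \1_A.
Proof.
move=> mA; split; first exact: measurable_indic.
by exists 1 => x; rewrite indicE; case: (_ \in _); rewrite ?normr1 ?normr0.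
Qed.

Lemma bmD f g : bounded_measurable f -> bounded_measurable g ->
  bounded_measurable (fun x => f x + g x).
Proof.
move=> [mf [C fC]] [mg [D gD]]; split; first exact: measurable_funD.
by exists (C + D) => x; rewrite (le_trans (ler_normD _ _))// lerD.
Qed.

Lemma bmM f g : bounded_measurable f -> bounded_measurable g ->
  bounded_measurable (fun x => f x * g x).
Proof.
move=> [mf [C fC]] [mg [D gD]]; split; first exact: measurable_funM.
by exists (C * D) => x; rewrite normrM ler_pM.
Qed.

Lemma bm_sum (I : Type) (s : seq I) (f : I -> Omega -> R) :
  (forall i, bounded_measurable (f i)) ->
  bounded_measurable (fun x => \sum_(i <- s) f i x).
Proof.
move=> bf; elim: s => [|i s IH].
  by under eq_fun do rewrite big_nil; exact: bm_cst.
by under eq_fun do rewrite big_cons; exact: bmD.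
Qed.

Local Notation Ex f := (\int[P]_x f x).

Lemma ExD f g : bounded_measurable f -> bounded_measurable g ->
  Ex (fun x => f x + g x) = Ex f + Ex g.
Proof. by move=> bf bg; rewrite RintegralD//; exact: bm_integrable. Qed.

Lemma ExZ c f : bounded_measurable f -> Ex (fun x => c * f x) = c * Ex f.
Proof. by move=> bf; rewrite RintegralZl//; exact: bm_integrable. Qed.

Lemma Ex_sum (I : Type) (s : seq I) (f : I -> Omega -> R) :
  (forall i, bounded_measurable (f i)) ->
  Ex (fun x => \sum_(i <- s) f i x) = \sum_(i <- s) Ex (f i).
Proof.
move=> bf; elim: s => [|i s IH].
  under eq_Rintegral do rewrite big_nil.
  by rewrite big_nil Rintegral_cst// mul0r.
under eq_Rintegral do rewrite big_cons.
by rewrite ExD ?IH ?big_cons//; exact: bm_sum.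
Qed.

Lemma Ex_indic A : measurable A -> Ex \1_A = pr A.
Proof. by move=> mA; rewrite /Rintegral integral_indic// setIT. Qed.

Lemma Ex_ge0 f : (forall x, 0 <= f x) -> 0 <= Ex f.
Proof. by move=> f0; apply: Rintegral_ge0. Qed.

Lemma le_Ex f g : bounded_measurable f -> bounded_measurable g ->
  (forall x, f x <= g x) -> Ex f <= Ex g.
Proof. by move=> bf bg fg; apply: le_Rintegral => //; exact: bm_integrable. Qed.

Lemma bmZ c f : bounded_measurable f -> bounded_measurable (fun x => c * f x).
Proof. by move=> bf; apply: bmM => //; exact: bm_cst. Qed.

Lemma bmB f g : bounded_measurable f -> bounded_measurable g ->
  bounded_measurable (fun x => f x - g x).
Proof.
move=> bf bg; under eq_fun do rewrite -mulN1r.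
by apply: bmD => //; exact: bmZ.
Qed.

Lemma ExB f g : bounded_measurable f -> bounded_measurable g ->
  Ex (fun x => f x - g x) = Ex f - Ex g.
Proof. by move=> bf bg; rewrite RintegralB//; exact: bm_integrable. Qed.

Lemma Ex_cst c : Ex (fun=> c) = c.
Proof. by rewrite Rintegral_cst// -[X in _ * X]/(pr setT) pr_setT mulr1. Qed.

Lemma measurable_exists (I : finType) (F : I -> set Omega) :
  (forall i, measurable (F i)) -> measurable [set om | exists i, F i om].
Proof.
move=> mF; rewrite (_ : [set _ | _] = \bigcup_i F i); last first.
  by apply/seteqP; split=> om /= [i]; [exists i|move=> _; exists i].
exact: fin_bigcup_measurable.
Qed.

Lemma pr_exists_le (I : finType) (F : I -> set Omega) :
  (forall i, measurable (F i)) ->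
  pr [set om | exists i, F i om] <= \sum_i pr (F i).
Proof.
move=> mF; have mU := measurable_exists mF; rewrite -(Ex_indic mU).
under eq_bigr do rewrite -(Ex_indic (mF _)).
have bF i := bm_indic (mF i).
rewrite -Ex_sum//; apply: le_Ex; [exact: bm_indic|exact: bm_sum|move=> om].
rewrite indicE; have [|_] := boolP (om \in _); last exact: sumr_ge0.
rewrite inE => -[i Fi]; rewrite (bigD1 i)//= indicE mem_set// lerDl.
exact: sumr_ge0.
Qed.

Lemma pr_exists (I : finType) (F : I -> set Omega) :
  (forall i, measurable (F i)) ->
  (forall i j om, F i om -> F j om -> i = j) ->
  pr [set om | exists i, F i om] = \sum_i pr (F i).
Proof.
move=> mF tF; apply/eqP; rewrite eq_le pr_exists_le//=.
have mU := measurable_exists mF; rewrite -(Ex_indic mU).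
under eq_bigr do rewrite -(Ex_indic (mF _)).
have bF i := bm_indic (mF i).
rewrite -Ex_sum//; apply: le_Ex; [exact: bm_sum|exact: bm_indic|move=> om].
have [[i Fi]|nF] := pselect (exists i, F i om); last first.
  rewrite big1// => i _; rewrite indicE memNset// => Fi.
  by apply: nF; exists i.
rewrite (bigD1 i)//= big1 ?addr0; last first.
  move=> j ji; rewrite indicE memNset// => Fj.
  by move: ji; rewrite (tF _ _ _ Fj Fi) eqxx.
by rewrite !indicE !mem_set//; exists i.
Qed.

(** * Bessel and Chebyshev inequalities for pairwise independent events *)

Context (I : finType) (A : I -> set Omega) (c : I -> R).
Hypothesis mA : forall k, measurable (A k).
Hypothesis indepA : forall k l, k != l -> pr (A k `&` A l) = pr (A k) * pr (A l).

Let Y k om := \1_(A k) om - pr (A k).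
Let Z om := \sum_k c k * Y k om.

Let bmY k : bounded_measurable (Y k).
Proof. by apply: bmB; [exact: bm_indic|exact: bm_cst]. Qed.

Let bmcY k : bounded_measurable (fun om => c k * Y k om).
Proof. exact: bmZ. Qed.

Let bmZs : bounded_measurable Z.
Proof. exact: bm_sum. Qed.

Let Ex_indicM B C : measurable B -> measurable C ->
  Ex (fun om => \1_B om * \1_C om) = pr (B `&` C).
Proof.
move=> mB mC; rewrite -Ex_indic; last exact: measurableI.
by congr Rintegral; apply/funext => om; rewrite indicI.
Qed.

Let Ex_indicZ E : measurable E -> Ex (fun om => \1_E om * Z om) =
  \sum_k c k * (pr (E `&` A k) - pr E * pr (A k)).
Proof.
move=> mE.
transitivity (Ex (fun om => \sum_k c k * (\1_E om * \1_(A k) om - pr (A k) * \1_E om))).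
  congr Rintegral; apply/funext => om; rewrite /Z mulr_sumr.
  by apply: eq_bigr => k _; rewrite /Y; ring.
have b1 k : bounded_measurable (fun om => \1_E om * \1_(A k) om).
  by apply: bmM; exact: bm_indic.
have b2 k : bounded_measurable (fun om => pr (A k) * \1_E om).
  by apply: bmZ; exact: bm_indic.
rewrite Ex_sum; last by move=> k; apply: bmZ; exact: bmB.
apply: eq_bigr => k _; rewrite ExZ; last exact: bmB.
rewrite ExB// ExZ; last exact: bm_indic.
by rewrite Ex_indicM// Ex_indic// (mulrC (pr E)).
Qed.

(** Pairwise independence kills the cross terms, and each diagonal term carries a variance
    [p * (1 - p)], which is at most 1. *)
Let Ex_Z2 : Ex (fun om => Z om * Z om) <= \sum_k c k ^+ 2.
Proof.
have YY k l : Ex (fun om => Y k om * Y l om) = if k == l then pr (A k) * (1 - pr (A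
    k)) else 0.
  transitivity (Ex (fun om => \1_(A k) om * \1_(A l) om -
    (pr (A k) * \1_(A l) om + (pr (A l) * \1_(A k) om - pr (A k) * pr (A l))))).
    by congr Rintegral; apply/funext => om; rewrite /Y; ring.
  have bi j := bm_indic (mA j).
  have bc := bm_cst (pr (A k) * pr (A l)).
  rewrite ExB; [|exact: bmM|apply: bmD; [exact: bmZ|apply: bmB => //; exact: bmZ]].
  rewrite ExD; [|exact: bmZ|by apply: bmB => //; exact: bmZ].
  rewrite ExB; [|exact: bmZ|by []].
  rewrite (ExZ _ (bi k)) (ExZ _ (bi l)) !Ex_indic// Ex_cst Ex_indicM//.
  case: eqP => [<-|/eqP kl]; first by rewrite setIid; ring.
  by rewrite indepA//; ring.
have -> : Ex (fun om => Z om * Z om) =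
    Ex (fun om => \sum_k \sum_l c k * c l * (Y k om * Y l om)).
  congr Rintegral; apply/funext => om; rewrite /Z mulr_suml.
  apply: eq_bigr => k _; rewrite mulr_sumr; apply: eq_bigr => l _; ring.
rewrite Ex_sum; last first.
  by move=> k; apply: bm_sum => l; apply: bmZ; exact: bmM.
apply: ler_sum => k _; rewrite Ex_sum; last by move=> l; apply: bmZ; exact: bmM.
rewrite (bigD1 k)//= big1 ?addr0; last first.
  move=> l lk; rewrite ExZ; last exact: bmM.
  by rewrite YY eq_sym (negbTE lk) mulr0.
rewrite ExZ; last exact: bmM.
rewrite YY eqxx -expr2; have := pr_ge0 (A k); have := pr_le1 (mA k).
set p := pr _ => p1 p0; rewrite -[leRHS]mulr1 ler_wpM2l ?sqr_ge0//; nra.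
Qed.

(* Expand [E (1_E - s * Z)^2 >= 0] where [Z] is the centred weighted count. *)
Lemma bessel_indep E s : measurable E ->
  2 * s * (\sum_k c k * (pr (E `&` A k) - pr E * pr (A k))) <=
  pr E + s ^+ 2 * \sum_k c k ^+ 2.
Proof.
move=> mE; rewrite -Ex_indicZ//.
have b1 : bounded_measurable (fun om => 2 * s * (\1_E om * Z om)).
  by apply: bmZ; apply: bmM => //; exact: bm_indic.
have b2 : bounded_measurable (fun om => s ^+ 2 * (Z om * Z om)).
  by apply: bmZ; exact: bmM.
have : 0 <= Ex (fun om => \1_E om + (s ^+ 2 * (Z om * Z om) - 2 * s * (\1_E om * Z
    om))).
  apply: Ex_ge0 => om; rewrite indicE.
  case: (_ \in _) => /=; last by rewrite mul0r mulr0 subr0 add0r mulr_ge0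
      ?sqr_ge0// -expr2 sqr_ge0.
  rewrite (_ : _ + _ = (1 - s * Z om) ^+ 2) ?sqr_ge0//; ring.
rewrite ExD//; [|exact: bm_indic|exact: bmB].
rewrite ExB// !ExZ; [|by apply: bmM => //; exact: bm_indic|exact: bmM].
rewrite Ex_indic// => h.
have : s ^+ 2 * Ex (fun om => Z om * Z om) <= s ^+ 2 * \sum_k c k ^+ 2.
  by rewrite ler_wpM2l ?sqr_ge0// Ex_Z2.
lra.
Qed.

(** Bessel's inequality is applied to the tail event [E] itself with [s = D^-1]. On [E] the sum is
    at least [D], so the left side is at least [2 * pr E], and one [pr E] cancels. *)
Lemma chebyshev_indep D : 0 < D ->
  pr [set om | D <= \sum_k c k * (\1_(A k) om - pr (A k))] <=
  (\sum_k c k ^+ 2) / D ^+ 2.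
Proof.
move=> D0; set E := [set om | _].
have mE : measurable E.
  rewrite (_ : E = Z @^-1` `[D, +oo[).
    by have [mZ _] := bmZs; rewrite -[X in measurable X]setTI; exact: mZ.
  by apply/seteqP; split => om; rewrite /= in_itv/= andbT.
have := bessel_indep D^-1 mE; rewrite -Ex_indicZ//.
have bi := bm_indic mE.
have : 0 <= Ex (fun om => \1_E om * Z om - D * \1_E om).
  apply: Ex_ge0 => om; rewrite (mulrC D) -mulrBr indicE.
  have [|_] := boolP (om \in E); last by rewrite mul0r.
  by rewrite inE /E/= -/(Z om) mul1r subr_ge0.
rewrite ExB; [|exact: bmM|exact: bmZ].
rewrite ExZ// Ex_indic// subr_ge0 => h1 h2.
have : 2 * D^-1 * (D * pr E) <= 2 * D^-1 * Ex (fun om => \1_E om * Z om).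
  by rewrite ler_wpM2l// mulr_ge0// invr_ge0 ltW.
rewrite mulrA -(mulrA 2) mulVf ?gt_eqF// mulr1 => h3.
rewrite exprVn in h2; rewrite [leRHS]mulrC; lra.
Qed.

End real_probability.

(** * A fixed assembly *)

Section mass.
Context {R : realType} {m : nat}.
Variable w : 'I_m -> R.
Hypothesis w_ge0 : forall k, 0 <= w k.

(** With [D] empty and [y = x i] this is the [V_i] of the overview. A nonempty [D] leaves out
    members whose positions are to be kept independent of the result. *)
Definition mass (D : {set 'I_m}) (x : 'I_m -> R) (y : R) : R :=
  \sum_(k | (k \notin D) && (x k < y)) w k.

Lemma mass_mono D x y z : y <= z -> mass D x y <= mass D x z.
Proof.
move=> yz; rewrite /mass [leLHS]big_mkcond [leRHS]big_mkcond /=.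
apply: ler_sum => k _; case: (k \notin D) => //=.
have [xy|_] := boolP (x k < y); first by rewrite (lt_le_trans xy yz).
by case: ifP.
Qed.

Lemma mass_setU1 (D : {set 'I_m}) i x y : i \notin D ->
  mass D x y = (if x i < y then w i else 0) + mass (i |: D)%SET x y.
Proof.
move=> iD; rewrite /mass [LHS]big_mkcond (bigD1 i)//= iD/=; congr (_ + _).
rewrite -big_mkcondr/=; apply: eq_bigl => k.
by rewrite !inE negb_or; case: (k == i) => //=; case: (k \notin D).
Qed.

(** A pivot at quota [t] means that [t] lies in the interval from [V_i] (included) to [V_i + w_i]
    (excluded). The jump shows that these intervals are disjoint for untied representatives, hence
    that the pivot is unique. *)
Lemma mass_jump x (i j : 'I_m) : i != j -> x i < x j ->
  mass finset.set0 x (x i) + w i <= mass finset.set0 x (x j).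
Proof.
move=> ij xij; rewrite !(mass_setU1 _ _ (_ : i \notin finset.set0)) ?inE//.
rewrite ltxx xij add0r addrC lerD2l; exact/mass_mono/ltW.
Qed.

Lemma measurable_mass D :
  measurable_fun setT (fun p : m.-tuple R * R => mass D (tnth p.1) p.2).
Proof.
rewrite /mass; under eq_fun do rewrite big_mkcond /=.
apply: measurable_sum => k.
case: (k \notin D) => //=.
apply: measurable_fun_ifT => //.
apply: measurable_fun_ltr => //.
exact: (measurableT_comp (measurable_tnth k) measurable_fst).
Qed.

End mass.

Section fixed_assembly.
Context d (Omega : measurableType d) (R : realType) (P : probability Omega R).
Context (m : nat) (w : 'I_m -> R) (X : 'I_m -> {RV P >-> R}).
Hypothesis w_ge0 : forall k, 0 <= w k.
Hypothesis iX : indep_family X.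
Hypothesis atomless : forall k y, P (X k @^-1` [set y]) = 0%E.

Local Notation pr := (fprob P).
Local Notation at_ om := (fun k => X k om).

Definition left_mass (i : 'I_m) (om : Omega) : R :=
    mass w finset.set0 (at_ om) (X i om).

Lemma measurable_mass_RV D (Y : Omega -> R) : measurable_fun setT Y ->
  measurable_fun setT (fun om => mass w D (at_ om) (Y om)).
Proof.
move=> mY.
rewrite (_ : (fun _ => _) =
  (fun p : m.-tuple R * R => mass w D (tnth p.1) p.2) \o
  (fun om => (rtuple X om, Y om))); last first.
  apply/funext => om /=; rewrite /mass; apply: eq_bigl => k.
  by rewrite tnth_mktuple.
apply: measurableT_comp; first exact: measurable_mass.
by apply/measurable_fun_pairP; split => //; exact: measurable_rtuple.
Qed.

Lemma measurable_lmass i : measurable_fun setT (left_mass i).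
Proof. by apply: measurable_mass_RV; exact: measurable_funPT. Qed.

Lemma measurable_leset (Y : Omega -> R) t : measurable_fun setT Y ->
  measurable [set om | Y om <= t].
Proof.
move=> mY; rewrite (_ : [set _ | _] = setT `&` Y @^-1` `]-oo, t]); first exact: mY.
by rewrite setTI; apply/seteqP; split=> om /=; rewrite in_itv.
Qed.

Lemma measurable_gtset (Y : Omega -> R) t : measurable_fun setT Y ->
  measurable [set om | t < Y om].
Proof.
move=> mY; rewrite (_ : [set _ | _] = setT `&` Y @^-1` `]t, +oo[); first exact: mY.
by rewrite setTI; apply/seteqP; split=> om /=; rewrite in_itv/= andbT.
Qed.

Lemma measurable_itvset (Y : Omega -> R) s t : measurable_fun setT Y ->
  measurable [set om | s < Y om <= t].
Proof.
move=> mY; rewrite (_ : [set _ | _] = setT `&` Y @^-1` `]s, t]); first exact: mY.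
by rewrite setTI; apply/seteqP; split=> om /=; rewrite in_itv.
Qed.

Definition cdf_lmass i t := pr [set om | left_mass i om <= t].

Lemma pr_itv_lmass i s t : s <= t ->
  pr [set om | s < left_mass i om <= t] = cdf_lmass i t - cdf_lmass i s.
Proof.
move=> st; have mV := measurable_lmass i; apply/eqP; rewrite eq_sym subr_eq.
rewrite /cdf_lmass (pr_setID P (measurable_leset t mV) (measurable_leset s mV)).
rewrite addrC; apply/eqP; congr (pr _ + pr _); apply/seteqP; split=> om /=.
- by move=> [Vt /negP]; rewrite -ltNge => ->.
- by move=> /andP[sV ->]; split=> //; apply/negP; rewrite -ltNge.
- by case.
- by move=> Vs; split => //; exact: le_trans Vs st.
Qed.

Definition no_ties := [set om | forall k l, k != l -> X k om != X l om].

(** With the other positions frozen, the section of the diagonal is a single point, which has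
    probability 0. *)
Lemma pr_tie k l : k != l -> pr [set om | X k om = X l om] = 0.
Proof.
move=> kl; pose E := [set p : m.-tuple R * R | tnth p.1 k = p.2].
have mE : measurable E.
  rewrite (_ : E = setT `&` (fun p : m.-tuple R * R => tnth p.1 k == p.2) @^-1`
      [set true]).
    apply: measurable_fun_eqr => //.
    exact: (measurableT_comp (measurable_tnth k) measurable_fst).
  by rewrite setTI; apply/seteqP; split=> p /= /eqP.
have lD : l \in [set l]%SET by rewrite inE.
have := indep_erase_prod iX lD mE.
rewrite (_ : [set _ | _] = [set om | X k om = X l om]); last first.
  by apply/seteqP; split=> om; rewrite /E/= tnth_mktuple /erase inE (negbTE kl).
rewrite integral0_eq; first by rewrite /fprob => ->.
move=> x _; rewrite /distribution /pushforward.
rewrite (_ : xsection E x = [set tnth x k]) ?atomless//.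
by apply/seteqP; split=> y; rewrite xsectionE/= => ->.
Qed.

Lemma measurable_tie k l : measurable [set om | X k om = X l om].
Proof.
rewrite (_ : [set _ | _] = setT `&` (fun om => X k om == X l om) @^-1` [set true]).
  by apply: measurable_fun_eqr.
by rewrite setTI; apply/seteqP; split=> p /= /eqP.
Qed.

Let tie (p : 'I_m * 'I_m) := [set om | p.1 != p.2 /\ X p.1 om = X p.2 om].

Let measurable_tie_pair p : measurable (tie p).
Proof.
rewrite /tie; case: eqP => /= _.
  by rewrite (_ : [set _ | _] = set0)//; apply/seteqP; split => // om [].
rewrite (_ : [set _ | _] = [set om | X p.1 om = X p.2 om]).
  exact: measurable_tie.
by apply/seteqP; split => om; [case|split].
Qed.

Let no_tiesE : no_ties = ~` [set om | exists p, tie p om].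
Proof.
apply/seteqP; split=> om /=.
  by move=> H [[k l]] [/= kl /eqP]; apply/negP/H.
move=> H k l kl; apply/eqP => Xkl; apply: H.
by exists (k, l).
Qed.

Lemma measurable_no_ties : measurable no_ties.
Proof. by rewrite no_tiesE; apply/measurableC/measurable_exists. Qed.

Lemma pr_no_ties : pr no_ties = 1.
Proof.
have mT := measurable_exists measurable_tie_pair.
have T0 : pr [set om | exists p, tie p om] = 0.
  apply/eqP; rewrite eq_le pr_ge0 andbT.
  apply: le_trans (pr_exists_le P measurable_tie_pair) _.
  rewrite big1// => -[k l] _; rewrite /tie/=; have [->|kl] := eqVneq k l.
    by rewrite (_ : [set _ | _] = set0) /fprob ?measure0//; apply/seteqP;
        split => // om [].
  rewrite (_ : [set _ | _] = [set om | X k om = X l om]) ?pr_tie//.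
  by apply/seteqP; split => om; [case|split].
by rewrite no_tiesE /fprob probability_setC// prE// T0 sube0.
Qed.

(** Transposing [i] and [j] gives an independent family [Y] with the same marginals, hence the same
    joint law. Since the two weights agree, [V_i] computed from [Y] is [V_j] computed from [X]. *)
Lemma cdf_lmass_exch i j t : w i = w j ->
  (forall A, measurable A -> P (X i @^-1` A) = P (X j @^-1` A)) ->
  cdf_lmass i t = cdf_lmass j t.
Proof.
move=> wij Xij; have [->//|ij] := eqVneq i j.
pose s := tperm i j; pose Y k := X (s k).
have iY : indep_family Y.
  move=> H mH; pose K k := H (s k).
  rewrite (_ : [set _ | _] = [set om | forall k, K k (X k om)]).
    rewrite iX; last by move=> k; exact: mH.
    rewrite (reindex_inj (@perm_inj _ s))/=.
    by apply: eq_bigr => k _; rewrite /K /Y tpermK.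
  apply/seteqP; split=> om /= HX k; rewrite /K /Y.
    by have := HX (s k); rewrite /Y /s tpermK.
  by have := HX (s k); rewrite /K /s tpermK.
have XY k A : measurable A -> P (X k @^-1` A) = P (Y k @^-1` A).
  by move=> mA; rewrite /Y /s; case: tpermP => [->|->|//]; rewrite Xij.
pose B := [set x : m.-tuple R | mass w finset.set0 (tnth x) (tnth x i) <= t].
have mB : measurable B.
  pose g := (fun p : m.-tuple R * R => mass w finset.set0 (tnth p.1) p.2) \o
    (fun x => (x, tnth x i)).
  rewrite (_ : B = setT `&` g @^-1` `]-oo, t]).
    have mg : measurable_fun setT g.
      apply: measurableT_comp; first exact: measurable_mass.
      by apply/measurable_fun_pairP; split; [exact: measurable_id|exact:
          (measurable_tnth i)].
    exact: mg.
  by rewrite setTI; apply/seteqP; split=> x /=; rewrite in_itv.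
rewrite /cdf_lmass /fprob; congr fine; transitivity (P (rtuple X @^-1` B)).
  have VX om : mass w finset.set0 (tnth (rtuple X om)) (tnth (rtuple X om) i) =
      left_mass i om.
    by rewrite tnth_mktuple /left_mass /mass; apply: eq_bigl => k; rewrite tnth_mktuple.
  by congr (P _); apply/seteqP; split=> om; rewrite /B/= VX.
rewrite (indep_law_eq iX iY XY mB).
have VY om : mass w finset.set0 (tnth (rtuple Y om)) (tnth (rtuple Y om) i) =
    left_mass j om.
  rewrite tnth_mktuple /Y tpermL /left_mass /mass [RHS](reindex_inj (@perm_inj _ s))/=.
  apply: eq_big => [k|k _]; first by rewrite !inE tnth_mktuple.
  by rewrite /s; case: tpermP => [->|->|//].
by congr (P _); apply/seteqP; split=> om; rewrite /B/= VY.
Qed.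

End fixed_assembly.

(** * Pivot events at an arbitrary quota *)

Section pivots.
Context d (Omega : measurableType d) (R : realType) (P : probability Omega R).
Context (m : nat) (w : 'I_m -> R) (X : 'I_m -> {RV P >-> R}).
Hypothesis w_ge0 : forall k, 0 <= w k.
Hypothesis iX : indep_family X.
Hypothesis atomless : forall k y, P (X k @^-1` [set y]) = 0%E.

Local Notation pr := (fprob P).
Local Notation lmass := (left_mass w X).
Local Notation at_ om := (fun k => X k om).

Definition piv i t := [set om | t - w i < lmass i om <= t].

Lemma measurable_piv i t : measurable (piv i t).
Proof. by apply: measurable_itvset; exact: measurable_lmass. Qed.

Lemma pr_piv i t : pr (piv i t) = cdf_lmass w X i t - cdf_lmass w X i (t - w i).
Proof. by apply: pr_itv_lmass; rewrite lerBlDr lerDl. Qed.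

Lemma piv_disjoint i j t om : no_ties X om -> piv i t om -> piv j t om -> i = j.
Proof.
move=> nt pi pj; apply/eqP; apply: contraT => ij.
wlog Xij : i j pi pj ij / X i om < X j om.
  move=> H; have := nt _ _ ij; rewrite neq_lt => /orP[|]; first exact: H.
  by apply: H => //; rewrite eq_sym.
have := mass_jump w_ge0 (x := at_ om) ij Xij; rewrite -!/(lmass _ om).
by move: pi pj => /andP[pi _] /andP[_ pj] h; exfalso; lra.
Qed.

Definition class_piv (Q : {set 'I_m}) t := [set om | exists i, i \in Q /\ piv i t om].

Let F (Q : {set 'I_m}) t i := [set om | i \in Q /\ piv i t om].

Let mF Q t i : measurable (F Q t i).
Proof.
rewrite /F; have [iQ|iQ] := boolP (i \in Q).
  rewrite (_ : [set _ | _] = piv i t); first exact: measurable_piv.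
  by apply/seteqP; split => om; [case|split].
by rewrite (_ : [set _ | _] = set0)//; apply/seteqP; split => // om [].
Qed.

Lemma measurable_class_piv Q t : measurable (class_piv Q t).
Proof. by apply: measurable_exists; exact: mF. Qed.

(** Pivot events are disjoint off ties, and ties are null. Once exchangeability makes the summands
    of a type class equal, a bound on the single event on the left becomes a bound of order [1/m]
    for each member. *)
Lemma pr_class_piv (Q : {set 'I_m}) t : pr (class_piv Q t) = \sum_(i in Q) pr (piv i t).
Proof.
have mN := measurable_no_ties X; have N1 := pr_no_ties iX atomless.
rewrite -(pr_setIr (measurable_class_piv Q t) mN N1).
rewrite (_ : _ `&` _ = [set om | exists i, (F Q t i `&` no_ties X) om]); last first.
  apply/seteqP; split=> om /=; first by move=> [[i Fi] nt]; exists i.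
  by move=> [i [Fi nt]]; split => //; exists i.
rewrite (pr_exists P); last 2 first.
- by move=> i; exact: measurableI.
- by move=> i j om [[_ pi] nt] [[_ pj] _]; exact: piv_disjoint pi pj.
rewrite [RHS]big_mkcond/=; apply: eq_bigr => i _; case: ifP => iQ.
  rewrite -[RHS](pr_setIr (measurable_piv i t) mN N1); congr (fprob _ (_ `&` _)).
  by apply/seteqP; split => om; [case|split].
transitivity (pr set0); last by rewrite /fprob measure0.
by congr (fprob _ _); apply/seteqP; split => // om [[]]; rewrite iQ.
Qed.

Lemma mass_le_no_ties om i : no_ties X om ->
  \sum_(k | X k om <= X i om) w k = lmass i om + w i.
Proof.
move=> nt; rewrite (bigD1 i)//= addrC; congr (_ + _); rewrite /left_mass /mass.
apply: eq_bigl => k; rewrite inE/= le_eqVlt.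
have [->|ki] := eqVneq k i; first by rewrite ltxx andbF.
by rewrite andbT (negbTE (nt _ _ ki)).
Qed.

(** The pivot is the leftmost [i] whose weight up to and including itself exceeds [t]. If [V_i]
    exceeded [t] as well, the immediate predecessor of [i], whose cumulative weight is exactly
    [V_i], would contradict minimality. *)
Lemma piv_exists om t : no_ties X om -> 0 <= t < \sum_k w k ->
  exists i, piv i t om.
Proof.
move=> nt /andP[t0 tW].
pose le_mass i := \sum_(k | X k om <= X i om) w k.
have le_massE i : le_mass i = lmass i om + w i by exact: mass_le_no_ties.
have m_gt0 : (0 < m)%N.
  by move: tW; case: (m) w => // w' ; rewrite big_ord0 ltNge t0.
pose i0 := Ordinal m_gt0.
have exmax (Q : pred 'I_m) k0 : Q k0 -> exists2 k, Q k & forall l, Q l -> X l om <=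
    X k om.
  move=> Qk0; case: (arg_maxP (fun k => X k om) Qk0) => k Qk kmax.
  by exists k => // l Ql; exact: kmax.
have [im _ im_max] := exmax predT i0 isT.
have Qim : t < le_mass im.
  by rewrite /le_mass (eq_bigl predT)// => k; rewrite im_max.
case: (@arg_minP _ _ _ im (fun k => t < le_mass k) (fun k => X k om) Qim) => /= i
    Qi imin.
exists i; apply/andP; split; first by move: Qi; rewrite le_massE; lra.
rewrite leNgt; apply/negP => tV.
(* Without anybody to the left [V_i = 0], which cannot exceed [t >= 0]; so a predecessor exists. *)
have [k0 k0i] : exists k0, X k0 om < X i om.
  apply/not_existsP => nk; move: tV; rewrite /left_mass /mass big_pred0 ?ltNge ?t0//.
  by move=> k; rewrite inE/=; apply/negP/nk.
have [k ki kmax] := exmax (fun k => X k om < X i om) _ k0i.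
have : t < le_mass k.
  rewrite /le_mass (eq_bigl (fun l => X l om < X i om)).
    by move: tV; congr (_ < _); rewrite /left_mass /mass; apply: eq_bigl => l;
        rewrite inE.
  move=> l; apply/idP/idP => [lk|]; first exact: le_lt_trans lk ki.
  exact: kmax.
by move=> /imin; rewrite leNgt ki.
Qed.

Lemma sum_pr_piv_ge1 t : 0 <= t < \sum_k w k -> 1 <= \sum_i pr (piv i t).
Proof.
move=> tW; rewrite -(pr_no_ties iX atomless).
apply: le_trans (pr_exists_le P (fun i => measurable_piv i t)).
apply: le_pr; first exact: measurable_no_ties.
  by apply: measurable_exists => i; exact: measurable_piv.
by move=> om nt; exact: piv_exists.
Qed.

End pivots.

(** * Shifting the quota *)

Section shift.
Context d (Omega : measurableType d) (R : realType) (P : probability Omega R).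
Context (m : nat) (w : 'I_m -> R) (X : 'I_m -> {RV P >-> R}).
Hypothesis w_ge0 : forall k, 0 <= w k.
Hypothesis iX : indep_family X.

Local Notation pr := (fprob P).
Local Notation lmass := (left_mass w X).
Local Notation at_ om := (fun k => X k om).
Local Notation total om y := (mass w finset.set0 (at_ om) y).

Lemma mass_without k om y :
  total om y = (if X k om < y then w k else 0) + mass w [set k]%SET (at_ om) y.
Proof. by rewrite (mass_setU1 _ _ _ (_ : k \notin finset.set0)) ?inE//
    finset.setU0. Qed.

Lemma pr_indep2 k l S T : k != l -> measurable S -> measurable T ->
  pr (X k @^-1` S `&` X l @^-1` T) = pr (X k @^-1` S) * pr (X l @^-1` T).
Proof.
move=> kl mS mT; pose B := [set x : m.-tuple R | S (tnth x k)].
have mB : measurable B.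
  rewrite -[B]setTI; exact: (measurable_tnth k).
have kB : rtuple (erase [set l]%SET X) @^-1` B = X k @^-1` S.
  by apply/seteqP; split=> om; rewrite /B/= tnth_mktuple /erase inE (negbTE kl).
have lD : l \in [set l]%SET by rewrite inE.
have mSk : measurable (X k @^-1` S) by exact: measurable_funPTI.
have mTl : measurable (X l @^-1` T) by exact: measurable_funPTI.
have := indep_erase iX lD mB mT; rewrite kB !prE//; last exact: measurableI.
by rewrite -EFinM => -[].
Qed.

Section average.
Variables (Q : {set 'I_m}) (S : set R) (p delta : R).
Hypothesis mS : measurable S.
Hypothesis pS : forall l, l \in Q -> pr (X l @^-1` S) = p.
Hypothesis p_gt0 : 0 < p.
Hypothesis delta_gt0 : 0 < delta.
Hypothesis Q_large : 1 <= delta ^+ 2 * #|Q|%:R.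

Let mXS l : measurable (X l @^-1` S).
Proof. exact: measurable_funPTI. Qed.

(** Bessel's inequality with the indicator of [Q] as coefficients and [s = delta] or [s = - delta].
    The term [pr E <= 1] is absorbed by [Q_large], so the average covariance of [E] with the
    positions of the members is at most [delta]. *)
Lemma pr_average_event E : measurable E ->
  `|\sum_(l in Q) pr (E `&` X l @^-1` S) - #|Q|%:R * (p * pr E)| <=
  delta * #|Q|%:R.
Proof.
move=> mE; pose c l : R := if l \in Q then 1 else 0.
have := bessel_indep c (fun l => mXS l)
  (fun k l kl => pr_indep2 kl mS mS) _ mE.
have -> : \sum_k c k ^+ 2 = #|Q|%:R.
  transitivity (\sum_k c k).
    by apply: eq_bigr => k _; rewrite /c; case: ifP; rewrite ?expr1n ?expr0n.
  by rewrite /c -big_mkcond/= sumr_const.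
have -> : \sum_k c k * (pr (E `&` X k @^-1` S) - pr E * pr (X k @^-1` S)) =
    \sum_(l in Q) pr (E `&` X l @^-1` S) - #|Q|%:R * (p * pr E).
  rewrite [in RHS]mulr_natl -sumr_const -sumrB [RHS]big_mkcond/=.
  apply: eq_bigr => k _; rewrite /c; case: ifP => kQ; last by rewrite mul0r.
  by rewrite mul1r pS// mulrC.
set z := _ - _; move=> H.
have E1 := pr_le1 P mE.
have {}H s : s ^+ 2 = delta ^+ 2 -> s * z <= delta * (delta * #|Q|%:R).
  move=> s2; have := H s; rewrite s2 (mulrA delta) -expr2 -mulrA.
  by move: (s * z) (delta ^+ 2 * _) Q_large => u v; lra.
rewrite ler_norml; apply/andP; split; last first.
  by have := H delta erefl; rewrite ler_pM2l.
have := H (- delta) (sqrrN _).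
by rewrite mulNr -mulrN ler_pM2l// lerNl.
Qed.

(** The average depends on [E'] only. Two events compared with the same family [E'] are therefore
    close to each other. *)
Lemma pr_close_average E (E' : 'I_m -> set Omega) e : measurable E ->
  (forall l, l \in Q -> `|pr (E `&` X l @^-1` S) - pr (E' l) * p| <= e) ->
  `|pr E - (\sum_(l in Q) pr (E' l)) / #|Q|%:R| <= (e + delta) / p.
Proof.
move=> mE HE; have n0 : 0 < #|Q|%:R :> R.
  by rewrite ltr0n lt0n; apply: contraTneq Q_large => ->; rewrite mulr0 -ltNge.
have h1 := pr_average_event mE.
have h2 : `|\sum_(l in Q) pr (E `&` X l @^-1` S) - (\sum_(l in Q) pr (E' l)) * p| <=
    e * #|Q|%:R.
  rewrite mulr_suml -sumrB (le_trans (ler_norm_sum _ _ _))//.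
  by rewrite mulr_natr -sumr_const; apply: ler_sum.
rewrite ler_pdivlMr// -(ler_pM2r n0).
rewrite -[X in `|_| * X](gtr0_norm p_gt0) -[X in _ * X <= _](gtr0_norm n0) -!normrM.
rewrite (_ : _ * p * _ = #|Q|%:R * (p * pr E) - (\sum_(l in Q) pr (E' l)) * p);
    last first.
  by field; exact: lt0r_neq0.
set s := \sum_(l in Q) pr (E `&` _) in h1 h2.
rewrite mulrDl [leRHS]addrC (le_trans (ler_distD s _ _))// lerD//.
by rewrite distrC.
Qed.

End average.

Section class_shift.
Variables (Q : {set 'I_m}) (w0 t : R).
Hypothesis wQ : forall k, k \in Q -> w k = w0.

Let others_tuple l := [set x : m.-tuple R | exists i,
  (i \in Q /\ i != l) /\ t - w0 < mass w [set l]%SET (tnth x) (tnth x i) <= t].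

(** Some member of [Q] other than [l] is pivotal at [t] in the assembly without [l]. Since [X l]
    does not enter, the event is independent of it; [others_tuple] is its form as a set of
    positions. *)
Let others l := [set om | exists i,
  (i \in Q /\ i != l) /\ t - w0 < mass w [set l]%SET (at_ om) (X i om) <= t].

Let m_others_tuple l : measurable (others_tuple l).
Proof.
rewrite (_ : others_tuple l = \bigcup_(i in [set i | i \in Q /\ i != l])
    [set x : m.-tuple R | t - w0 < mass w [set l]%SET (tnth x) (tnth x i) <= t]).
  apply: fin_bigcup_measurable => // i _.
  pose g := (fun p : m.-tuple R * R => mass w [set l]%SET (tnth p.1) p.2) \o
    (fun x => (x, tnth x i)).
  rewrite (_ : [set _ | _] = setT `&` g @^-1` `]t - w0, t]).
    have mg : measurable_fun setT g.
      apply: measurableT_comp; first exact: measurable_mass.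
      by apply/measurable_fun_pairP; split; [exact: measurable_id|exact:
          (measurable_tnth i)].
    exact: mg.
  by rewrite setTI; apply/seteqP; split=> x /=; rewrite in_itv.
by apply/seteqP; split=> x /= [i]; [move=> [? ?]; exists i|move=> ? ?; exists i].
Qed.

Let othersE l : others l = rtuple (erase [set l]%SET X) @^-1` others_tuple l.
Proof.
have E om i : i != l -> mass w [set l]%SET (at_ om) (X i om) =
    mass w [set l]%SET (tnth (rtuple (erase [set l]%SET X) om))
      (tnth (rtuple (erase [set l]%SET X) om) i).
  move=> il; rewrite /mass; apply: eq_bigl => k; rewrite !tnth_mktuple.
  by rewrite /erase !inE (negbTE il); case: (k == l).
apply/seteqP; split=> om /= [i [[iQ il]]].
  by rewrite E// => h; exists i.
by rewrite -E// => h; exists i.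
Qed.

Let m_others l : measurable (others l).
Proof.
rewrite othersE -[X in measurable X]setTI; apply: measurable_rtuple => //.
Qed.

Let others_indep l S : measurable S ->
  pr (others l `&` X l @^-1` S) = pr (others l) * pr (X l @^-1` S).
Proof.
move=> mS; have lD : l \in [set l]%SET by rewrite inE.
have mXl : measurable (X l @^-1` S) by exact: measurable_funPTI.
have := indep_erase iX lD (m_others_tuple l) mS; rewrite -othersE !prE//.
  by rewrite -EFinM => -[].
exact: measurableI.
Qed.

Let close_of_sandwich (E E' A N : set Omega) e :
  measurable E -> measurable E' -> measurable A -> measurable N ->
  pr N <= e -> (forall om, A om -> ~ N om -> E om <-> E' om) ->
  `|pr (E `&` A) - pr (E' `&` A)| <= e.
Proof.
move=> mE mE' mA mN Ne EE'.
have sub F G : measurable F -> measurable G ->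
    (forall om, A om -> ~ N om -> F om -> G om) ->
    pr (F `&` A) <= pr (G `&` A) + pr N.
  move=> mF mG FG; apply: pr_le_setU => //; try exact: measurableI.
  move=> om [Fom Aom]; have [Nom|nN] := pselect (N om); first by right.
  by left; split => //; exact: FG.
have h1 : pr (E `&` A) <= pr (E' `&` A) + pr N.
  by apply: sub => // om Aom nN; move/(EE' _ Aom nN).
have h2 : pr (E' `&` A) <= pr (E `&` A) + pr N.
  by apply: sub => // om Aom nN; move/(EE' _ Aom nN).
rewrite ler_norml; lra.
Qed.

Variables (a b pA pB eA eB delta : R).
Hypothesis prA : forall k, k \in Q -> pr (X k @^-1` `]-oo, a[) = pA.
Hypothesis prB : forall k, k \in Q -> pr (X k @^-1` `]b, +oo[) = pB.
Hypothesis pA_gt0 : 0 < pA.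
Hypothesis pB_gt0 : 0 < pB.
Hypothesis delta_gt0 : 0 < delta.
Hypothesis Q_large : 1 <= delta ^+ 2 * #|Q|%:R.
Hypothesis small_a : pr [set om | t - w0 < total om a] <= eA.
Hypothesis small_b : pr [set om | total om b <= t] <= eB.

(* Representative [l] sits at the far left, so every pivot that is not
   exceptional lies to its right and sees the weight of the others plus [w0]. *)
Let left_claim l om : l \in Q -> X l om < a -> total om a <= t - w0 ->
  class_piv w X Q (t + w0) om <-> others l om.
Proof.
move=> lQ la ta; have wl := wQ lQ; have w0_ge0 : 0 <= w0 by rewrite -wl.
have base i := mass_without l om (X i om).
split=> -[i []].
  move=> iQ; rewrite /piv /= (wQ iQ) addrK => /andP[tV Vt].
  have ai : a <= X i om.
    rewrite leNgt; apply/negP => /ltW/(mass_mono w_ge0 finset.set0 (at_ om)).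
    by move=> h; move: tV; rewrite /left_mass; lra.
  have li := lt_le_trans la ai.
  exists i; split; first by split=> //; apply: contraTneq li => ->; rewrite ltxx.
  by move: tV Vt; rewrite /left_mass base li wl => ? ?; apply/andP; split; lra.
move=> [iQ il] /andP[tV Vt]; exists i; split => //.
have ai : a <= X i om.
  rewrite leNgt; apply/negP => /ltW/(mass_mono w_ge0 [set l]%SET (at_ om)) h.
  by move: ta; rewrite (mass_without l om) la wl; lra.
have li := lt_le_trans la ai.
by rewrite /piv/= (wQ iQ) addrK /left_mass base li wl; apply/andP; split; lra.
Qed.

(** Mirror image of [left_claim]: beyond [b] the mass already exceeds [t], so a pivot lies to the
    left of [l] and does not see its weight. The quota stays [t], yet the resulting event is the
    same [others l]. *)
Let right_claim l om : l \in Q -> b < X l om -> t < total om b ->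
  class_piv w X Q t om <-> others l om.
Proof.
move=> lQ bl tb; have wl := wQ lQ.
have base i : X i om <= b ->
    total om (X i om) = mass w [set l]%SET (at_ om) (X i om).
  by move=> ib; rewrite (mass_without l om) ltNge (ltW (le_lt_trans ib bl)) add0r.
split=> -[i []].
  move=> iQ; rewrite /piv /= (wQ iQ) => /andP[tV Vt].
  have ib : X i om <= b.
    rewrite leNgt; apply/negP => /ltW/(mass_mono w_ge0 finset.set0 (at_ om)).
    by move=> h; move: Vt; rewrite /left_mass; lra.
  exists i; split.
    by split=> //; apply: contraTneq (le_lt_trans ib bl) => ->; rewrite ltxx.
  by rewrite -base//; apply/andP; split.
move=> [iQ il] /andP[tV Vt]; exists i; split => //.
have ib : X i om <= b.
  rewrite leNgt; apply/negP => /ltW/(mass_mono w_ge0 [set l]%SET (at_ om)) h.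
  by move: tb; rewrite (mass_without l om) [X l om < b]ltNge (ltW bl)/= add0r; lra.
by rewrite /piv/= (wQ iQ) /left_mass base// tV Vt.
Qed.

(** Both class events are compared with the same average of [pr (others l)]: the one at [t + w0]
    through members [l] placed left of [a], the one at [t] through members placed right of [b].
    Restricting to these positions costs the factors [1 / pA] and [1 / pB]. *)
Lemma class_piv_shift :
  `|pr (class_piv w X Q (t + w0)) - pr (class_piv w X Q t)| <=
  (eA + delta) / pA + (eB + delta) / pB.
Proof.
have mN1 : measurable [set om | t - w0 < total om a].
  by apply: measurable_gtset; apply: measurable_mass_RV.
have mN2 : measurable [set om | total om b <= t].
  by apply: measurable_leset; apply: measurable_mass_RV.
have mE s := measurable_class_piv w X Q s.
have hA : `|pr (class_piv w X Q (t + w0)) - (\sum_(l in Q) pr (others l)) / #|Q|%:R| <=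
    (eA + delta) / pA.
  apply: (pr_close_average (S := `]-oo, a[%classic)) => // l lQ.
  rewrite -(prA lQ) -others_indep//.
  apply: close_of_sandwich mN1 small_a _ => //.
    exact: measurable_funPTI.
  move=> om; rewrite /= in_itv/= => la /negP; rewrite -leNgt; exact: left_claim.
have hB : `|pr (class_piv w X Q t) - (\sum_(l in Q) pr (others l)) / #|Q|%:R| <=
    (eB + delta) / pB.
  apply: (pr_close_average (S := `]b, +oo[%classic)) => // l lQ.
  rewrite -(prB lQ) -others_indep//.
  apply: close_of_sandwich mN2 small_b _ => //.
    exact: measurable_funPTI.
  move=> om; rewrite /= in_itv/= andbT => lb /negP; rewrite -ltNge; exact: right_claim.
rewrite distrC in hB.
exact: le_trans (ler_distD _ _ _) (lerD hA hB).
Qed.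

End class_shift.
End shift.

(** * Comparing two representatives *)

Section comparison.
Context d (Omega : measurableType d) (R : realType) (P : probability Omega R).
Context (m : nat) (w : 'I_m -> R) (X : 'I_m -> {RV P >-> R}).
Hypothesis w_ge0 : forall k, 0 <= w k.
Hypothesis iX : indep_family X.

Local Notation pr := (fprob P).
Local Notation lmass := (left_mass w X).
Local Notation at_ om := (fun k => X k om).
Local Notation total om y := (mass w finset.set0 (at_ om) y).

Let mXS l S : measurable S -> measurable (X l @^-1` S).
Proof. by move=> mS; exact: measurable_funPTI. Qed.

Let total_indic om y :
  total om y = \sum_k w k * \1_(X k @^-1` `]-oo, y[) om.
Proof.
rewrite /mass big_mkcond/=; apply: eq_bigr => k _; rewrite inE/= indicE.
have [ky|ky] := boolP (X k om < y).
  by rewrite mem_set ?mulr1//= in_itv.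
by rewrite memNset ?mulr0//= in_itv/=; exact/negP.
Qed.

(** The mass left of a fixed point is a weighted sum of independent indicators, and [D] bounds the
    distance from its mean to the threshold from below. *)
Lemma pr_mass_gt y s D : 0 < D ->
  D <= s - \sum_k w k * pr (X k @^-1` `]-oo, y[) ->
  pr [set om | s < total om y] <= (\sum_k w k ^+ 2) / D ^+ 2.
Proof.
move=> D0 hD; pose A k := X k @^-1` `]-oo, y[.
have mA k : measurable (A k) by exact: mXS.
apply: le_trans (chebyshev_indep w mA
  (fun k l kl => pr_indep2 iX kl (measurable_itv _) (measurable_itv _)) D0).
apply: le_pr.
- by apply: measurable_gtset; exact: measurable_mass_RV.
- rewrite (_ : [set _ | _] = (fun om => \sum_k w k * (\1_(A k) om - pr (A k)))
    @^-1` `[D, +oo[).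
    rewrite -[X in measurable X]setTI.
    suff : measurable_fun setT (fun om => \sum_k w k * (\1_(A k) om - pr (A k))) by
        apply.
    apply: measurable_sum => k; apply: measurable_funM => //.
    by apply: measurable_funB => //; exact: measurable_indic.
  by apply/seteqP; split=> om; rewrite /= in_itv/= andbT.
- move=> om /=; rewrite total_indic; under [X in _ -> _ <= X]eq_bigr do rewrite mulrBr.
  rewrite sumrB /A; lra.
Qed.

Lemma pr_mass_le y s D : 0 < D ->
  D <= \sum_k w k * pr (X k @^-1` `]-oo, y[) - s ->
  pr [set om | total om y <= s] <= (\sum_k w k ^+ 2) / D ^+ 2.
Proof.
move=> D0 hD; pose A k := X k @^-1` `]-oo, y[.
have mA k : measurable (A k) by exact: mXS.
(* The lower tail is the upper tail for the coefficients [- w k]. *)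
rewrite (eq_bigr (fun k => (- w k) ^+ 2)); last by move=> k _; rewrite sqrrN.
apply: le_trans (chebyshev_indep (fun k => - w k) mA
  (fun k l kl => pr_indep2 iX kl (measurable_itv _) (measurable_itv _)) D0).
apply: le_pr.
- by apply: measurable_leset; exact: measurable_mass_RV.
- rewrite (_ : [set _ | _] = (fun om => \sum_k - w k * (\1_(A k) om - pr (A k)))
    @^-1` `[D, +oo[).
    rewrite -[X in measurable X]setTI.
    suff : measurable_fun setT (fun om => \sum_k - w k * (\1_(A k) om - pr (A k)))
        by apply.
    apply: measurable_sum => k; apply: measurable_funM => //.
    by apply: measurable_funB => //; exact: measurable_indic.
  by apply/seteqP; split=> om; rewrite /= in_itv/= andbT.
- move=> om /=; rewrite total_indic.
  under [X in _ -> _ <= X]eq_bigr do rewrite mulNr mulrBr opprB.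
  rewrite sumrB /A; lra.
Qed.

Section pair.
Variables (i j : 'I_m) (a b kappa q L : R).
Hypothesis ij : i != j.
Hypothesis kappa_ge0 : 0 <= kappa.
Hypothesis L_ge0 : 0 <= L.
Hypothesis dominated : forall S, measurable S -> S `<=` `[a, b] ->
  (P (X i @^-1` S) <= kappa%:E * P (X j @^-1` S))%E.

Let D := [set i; j]%SET.
(** With both [i] and [j] left out, [rest i] and [rest j] are one random step function, independent
    of [X i] and [X j], evaluated at these two points. *)
Let rest k om := mass w D (at_ om) (X k om).

Let lmass_i om : lmass i om = (if X j om < X i om then w j else 0) + rest i om.
Proof.
rewrite /left_mass (mass_without _ _ j) (mass_setU1 _ _ _ (_ : i \notin [set j]%SET)).
  by rewrite ltxx add0r.
by rewrite inE.
Qed.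

Let lmass_j om : lmass j om = (if X i om < X j om then w i else 0) + rest j om.
Proof.
rewrite /left_mass (mass_without _ _ i) (mass_setU1 _ _ _ (_ : j \notin [set i]%SET)).
  by rewrite ltxx add0r /rest /D finset.setUC.
by rewrite inE eq_sym.
Qed.

Let m_rest k : measurable_fun setT (rest k).
Proof. by apply: measurable_mass_RV; exact: measurable_funPT. Qed.

(** With the other positions frozen, the window becomes a fixed set of positions, the same for [i]
    and [j]. Its part inside [[a, b]] is covered by [dominated], and integration over the others
    gives the claim. *)
Let pr_rest_window :
  pr [set om | q < rest i om <= q + L /\ a <= X i om <= b] <=
  kappa * pr [set om | q < rest j om <= q + L].
Proof.
pose g (p : m.-tuple R * R) := mass w D (tnth p.1) p.2.
have mg : measurable_fun setT g by exact: measurable_mass.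
pose F := [set p | q < g p <= q + L].
have mF : measurable F.
  rewrite (_ : F = setT `&` g @^-1` `]q, q + L]); first exact: mg.
  by rewrite setTI; apply/seteqP; split=> om /=; rewrite in_itv.
pose E := F `&` (snd @^-1` `[a, b]).
have mE : measurable E.
  apply: measurableI => //; rewrite -[X in measurable X]setTI.
  exact: measurable_snd.
have iD : i \in D by rewrite !inE eqxx.
have jD : j \in D by rewrite !inE eqxx orbT.
have restE k om : g (rtuple (erase D X) om, X k om) = rest k om.
  rewrite /g /rest /mass /=; apply: eq_bigl => l; rewrite tnth_mktuple /erase.
  by case: (l \in D).
have Pj := indep_erase_prod iX jD mF.
rewrite [X in P X](_ : _ = [set om | q < rest j om <= q + L]) in Pj; last first.
  by apply/seteqP; split=> om; rewrite /mkset -restE.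
have Pi := indep_erase_prod iX iD mE.
rewrite [X in P X](_ : _ = [set om | q < rest i om <= q + L /\ a <= X i om <=
    b]) in Pi; last first.
  by apply/seteqP; split=> om; rewrite /mkset -restE /E/= in_itv.
have m1 : measurable [set om | q < rest j om <= q + L] by exact: measurable_itvset.
have m2 : measurable [set om | q < rest i om <= q + L /\ a <= X i om <= b].
  rewrite (_ : [set _ | _] = [set om | q < rest i om <= q + L] `&` X i @^-1` `[a, b]).
    by apply: measurableI; [exact: measurable_itvset|exact: mXS].
  by apply/seteqP; split=> om /=; rewrite in_itv.
rewrite -lee_fin EFinM -!prE// Pi Pj -ge0_integralZl ?lee_fin//; last first.
  exact: measurable_fun_xsection.
apply: ge0_le_integral => //.
- exact: measurable_fun_xsection.
- by apply: measurable_funeM; exact: measurable_fun_xsection.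
move=> x _; apply: (le_trans (dominated _ _)).
- exact: measurable_xsection.
- by move=> y; rewrite xsectionE => -[].
apply: lee_wpmul2l; first by rewrite lee_fin.
apply: le_measure; rewrite ?inE; try by apply: mXS; exact: measurable_xsection.
by move=> om /=; rewrite !xsectionE => -[].
Qed.

(* The five terms: the window for [j], the two boundary windows caused by the
   mutual weights of [i] and [j], and the tails outside [[a, b]]. *)
Lemma lmass_window_compare :
  pr [set om | q < lmass i om <= q + L] <=
  kappa * pr [set om | q < lmass j om <= q + L] +
  kappa * pr [set om | q + L < lmass j om <= q + L + w i] +
  pr [set om | q < lmass i om <= q + w j] +
  pr [set om | q < total om a] + pr [set om | total om b <= q + L].
Proof.
have mV k := measurable_lmass w X k.
have mI k s t : measurable [set om | s < lmass k om <= t] by exact: measurable_itvset.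
have mA : measurable [set om | q < total om a].
  by apply: measurable_gtset; exact: measurable_mass_RV.
have mB : measurable [set om | total om b <= q + L].
  by apply: measurable_leset; exact: measurable_mass_RV.
have mJ : measurable [set om | q < rest i om <= q + L /\ a <= X i om <= b].
  rewrite (_ : [set _ | _] = [set om | q < rest i om <= q + L] `&` X i @^-1` `[a, b]).
    by apply: measurableI; [exact: measurable_itvset|exact: mXS].
  by apply/seteqP; split=> om /=; rewrite in_itv.
have hj : pr [set om | q < rest j om <= q + L] <=
    pr [set om | q < lmass j om <= q + L] +
    pr [set om | q + L < lmass j om <= q + L + w i].
  apply: pr_le_setU => //; first exact: measurable_itvset.
  move=> om /= /andP[h1 h2]; have := lmass_j om; have := w_ge0 i.
  move: (rest j om) (lmass j om) h1 h2 => u v h1 h2 wi vE.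
  have [vL|vL] := leP v (q + L); [left|right]; apply/andP; split=> //.
    by move: vE; case: ifP => _ ->; lra.
  by move: vE; case: ifP => _ ->; lra.
have hi : pr [set om | q < lmass i om <= q + L] <=
    pr [set om | q < rest i om <= q + L /\ a <= X i om <= b] +
    (pr [set om | q < lmass i om <= q + w j] +
     (pr [set om | q < total om a] + pr [set om | total om b <= q + L])).
  have mAB : measurable ([set om | q < total om a] `|` [set om | total om b <= q + L]).
    exact: measurableU.
  have mU : measurable ([set om | q < lmass i om <= q + w j] `|`
      ([set om | q < total om a] `|` [set om | total om b <= q + L])).
    exact: measurableU.
  have hU : pr [set om | q < lmass i om <= q + L] <=
      pr [set om | q < rest i om <= q + L /\ a <= X i om <= b] +
      pr ([set om | q < lmass i om <= q + w j] `|`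
        ([set om | q < total om a] `|` [set om | total om b <= q + L])).
    apply: pr_le_setU mU _ => //.
    move=> om /= /andP[qV VL]; have VE := lmass_i om.
    have [aX|aX] := leP a (X i om); last first.
      right; right; left; apply: lt_le_trans qV _.
      exact/(mass_mono w_ge0)/ltW.
    have [Xb|Xb] := leP (X i om) b; last first.
      right; right; right; apply: le_trans VL.
      exact/(mass_mono w_ge0)/ltW.
    have [Uq|Uq] := leP (rest i om) q.
      right; left; rewrite qV/=; have := w_ge0 j.
      by move: VE; case: ifP => _ ->; lra.
    left; split; last by apply/andP; split.
    apply/andP; split=> //; apply: le_trans VL.
    by rewrite VE lerDr; case: ifP.
  apply: (le_trans hU); rewrite lerD2l; apply: le_trans (prU_le P (mI _ _ _) mAB) _.
  by rewrite lerD2l; exact: prU_le.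
have := ler_wpM2l kappa_ge0 hj; have := pr_rest_window; move: hi.
by rewrite mulrDr; lra.
Qed.

End pair.
End comparison.

(** * Finite assemblies cut from the infinite sequence *)

Section sequence.
Context d (Omega : measurableType d) (R : realType) (P : probability Omega R).
Variables (lam : nat -> {RV P >-> R}) (wt : nat -> R).
Hypothesis wt_ge0 : forall k, 0 <= wt k.
Hypothesis hindep : mutually_independent lam.
Hypothesis atomless : forall k y, P (lam k @^-1` [set y]) = 0%E.

Local Notation pr := (fprob P).

Definition first_lam m (k : 'I_m) : {RV P >-> R} := lam k.
Definition first_wt m (k : 'I_m) : R := wt k.

Lemma first_lam_indep m : indep_family (@first_lam m).
Proof.
move=> H mH; pose A k := if insub k is Some i then H i else setT : set R.
have mA k : measurable (A k) by rewrite /A; case: insubP.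
have AE (k : 'I_m) : A k = H k by rewrite /A valK.
have := hindep (iota_uniq 0 m) mA.
have -> : iota 0 m = index_iota 0 m by rewrite /index_iota subn0.
rewrite !big_mkord => hP.
transitivity (P (\big[setI/setT]_(i < m) (lam i @^-1` A i))).
  congr (P _); rewrite -(bigcap_mkord m (fun k => lam k @^-1` A k)); apply/seteqP;
      split=> om /= HX k.
    by move=> km; have := HX (Ordinal km); rewrite -AE.
  by have := HX k (ltn_ord k); rewrite /preimage/= AE.
by rewrite hP; apply: eq_bigr => k _; rewrite AE.
Qed.

(** The index [i] is a natural number, so that it can stay fixed while [m] grows. *)
Definition left_cdf m i t :=
  pr [set om | \sum_(k < m | lam k om < lam i om) wt k <= t].

Lemma left_cdfE m (i : 'I_m) t :
  left_cdf m i t = cdf_lmass (@first_wt m) (@first_lam m) i t.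
Proof.
rewrite /left_cdf /cdf_lmass /left_mass /mass; congr (fprob _ _); apply/eq_set => om.
by congr (is_true (_ <= _)); apply: eq_bigl => k; rewrite inE.
Qed.

(** Off ties the weight up to and including [lam i] is [V_i + w_i], which turns the two defining
    inequalities into [q - w_i < V_i <= q]. *)
Lemma pivot_probE m i : (i < m)%N ->
  let q := (\sum_(k < m) wt k) / 2 in
  pivot_prob lam wt m i = left_cdf m i q - left_cdf m i (q - wt i).
Proof.
move=> im q; pose I := Ordinal im.
have w0 k : 0 <= @first_wt m k by exact: wt_ge0.
have iX := @first_lam_indep m.
have aX (k : 'I_m) y : P (@first_lam m k @^-1` [set y]) = 0%E by exact: atomless.
rewrite (left_cdfE I) (left_cdfE I) -[wt i]/(@first_wt m I) -pr_piv//.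
rewrite -[LHS]/(pr _).
have mN := measurable_no_ties (@first_lam m); have N1 := pr_no_ties iX aX.
rewrite -(pr_setIr (measurable_piv _ _ I q) mN N1) -[LHS](pr_setIr _ mN N1).
  have VI om : left_mass (@first_wt m) (@first_lam m) I om =
      \sum_(k < m | lam k om < lam i om) wt k.
    by rewrite /left_mass /mass; apply: eq_bigl => k; rewrite inE.
  have VI' om : no_ties (@first_lam m) om ->
      \sum_(k < m | lam k om <= lam i om) wt k =
      left_mass (@first_wt m) (@first_lam m) I om + wt i.
    by move=> nt; exact: (mass_le_no_ties (@first_wt m) I nt).
  congr (fprob _ _); apply/seteqP; split=> om [E nt]; split=> //; move: E.
    by move=> [_ []]; rewrite VI'// -VI => h1 h2; apply/andP; split=> //;
        rewrite ltrBlDr.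
  rewrite /piv/= -[@first_wt m I]/(wt i) ltrBlDr => /andP[h1 h2].
  by split=> //; rewrite VI'// -VI; split.
rewrite (_ : pivot_event _ _ _ _ =
  [set om | \sum_(k < m | lam k om < lam i om) wt k <= q] `&`
  [set om | q < \sum_(k < m | lam k om <= lam i om) wt k]); last first.
  by apply/seteqP; split=> om; [move=> [_ []]|move=> []].
apply: measurableI.
  apply: measurable_leset; under eq_fun do rewrite big_mkcond /=.
  apply: measurable_sum => k; apply: measurable_fun_ifT => //.
  exact: measurable_fun_ltr.
apply: measurable_gtset; under eq_fun do rewrite big_mkcond /=.
apply: measurable_sum => k; apply: measurable_fun_ifT => //.
exact: measurable_fun_ler.
Qed.

End sequence.

(** * Probabilities from bounds on densities *)

Section local_density.
Context d (Omega : measurableType d) (R : realType) (P : probability Omega R).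
Local Notation pr := (fprob P).

Lemma density_atomless (X : {RV P >-> R}) f y :
  has_density X f -> P (X @^-1` [set y]) = 0%E.
Proof. by move=> ->//; rewrite integral_set1. Qed.

Lemma density_ge (X : {RV P >-> R}) f S v : has_density X f ->
  measurable_fun setT f -> measurable S -> 0 <= v ->
  (forall x, S x -> v <= f x) ->
  (v%:E * lebesgue_measure S <= P (X @^-1` S))%E.
Proof.
move=> hX mf mS v0 vf; rewrite hX// -integral_cst//; apply: ge0_le_integral => //.
by apply/measurable_EFinP; exact: measurable_funTS.
Qed.

Lemma density_le (X : {RV P >-> R}) f S v : has_density X f ->
  measurable_fun setT f -> measurable S -> (forall x, 0 <= f x) ->
  (forall x, S x -> f x <= v) ->
  (P (X @^-1` S) <= v%:E * lebesgue_measure S)%E.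
Proof.
move=> hX mf mS f0 vf; rewrite hX// -integral_cst//; apply: ge0_le_integral => //.
- by move=> x _; rewrite lee_fin.
- by apply/measurable_EFinP; exact: measurable_funTS.
Qed.

Lemma density_compare (X Y : {RV P >-> R}) f g S v : has_density X f ->
  has_density Y g -> measurable_fun setT f -> measurable_fun setT g ->
  measurable S -> 0 <= v -> (forall x, 0 <= f x) -> (forall x, 0 <= g x) ->
  (forall x, S x -> f x <= v * g x) ->
  (P (X @^-1` S) <= v%:E * P (Y @^-1` S))%E.
Proof.
move=> hX hY mf mg mS v0 f0 g0 fg; have mh h : measurable_fun setT h ->
    measurable_fun S (EFin \o h).
  by move=> mh; apply/measurable_EFinP; exact: measurable_funTS.
rewrite hX// hY// -ge0_integralZl ?lee_fin//; last 2 first.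
- exact: mh.
- by move=> x _; rewrite lee_fin.
apply: ge0_le_integral => //.
- by move=> x _; rewrite lee_fin.
- exact: mh.
- by apply: measurable_funeM; exact: mh.
Qed.

End local_density.

Local Ltac itv_lra :=
  repeat match goal with H : is_true (_ && _) |- _ => move/andP: H => [? ?] end;
  first [lra | apply/andP; split; lra].

(** * Densities near the common median *)

Section near_median.
Context d (Omega : measurableType d) (R : realType) (P : probability Omega R).
Variables (X : {RV P >-> R}) (f : R -> R) (M eps1 c : R).
Hypothesis mf : measurable_fun setT f.
Hypothesis f_ge0 : forall x, 0 <= f x.
Hypothesis densX : has_density X f.
Hypothesis medX : (\int[lebesgue_measure]_(x in `]-oo, M]) (f x)%:E)%E = (1 / 2)%:E.
Hypothesis fM_gt0 : 0 < f M.
Hypothesis eps1_gt0 : 0 < eps1.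
Hypothesis c_ge0 : 0 <= c.
Hypothesis f_near : forall x, M - eps1 <= x <= M + eps1 ->
  `|f x - f M| <= c * (x - M) ^+ 2.

Local Notation mu S := (fprob P (X @^-1` S)).

Let mXS S : measurable S -> measurable (X @^-1` S).
Proof. by move=> mS; exact: measurable_funPTI. Qed.

Lemma density_close v : 0 < v -> exists2 eta : R, (0 < eta) &
  forall x, M - eta <= x <= M + eta -> `|f x - f M| <= v.
Proof.
have c0 := c_ge0; move=> v0; have c1 : 0 < c + 1 by itv_lra.
(* The bound [eps1] keeps the local estimate valid, 1 gives [(x - M) ^+ 2 <= eta], and the
   denominator [c + 1] is nonzero even for [c = 0]. *)
exists (Num.min eps1 (Num.min 1 (v / (c + 1)))).
  by rewrite !lt_min eps1_gt0 ltr01 divr_gt0.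
set eta := Num.min _ _ => x xM.
have e1 : eta <= eps1 by rewrite ge_min lexx.
have e2 : eta <= 1 by rewrite !ge_min lexx orbT.
have e3 : eta * (c + 1) <= v by rewrite -ler_pdivlMr// !ge_min lexx !orbT.
apply: le_trans (f_near _) _; first by itv_lra.
have /andP[x1 x2] : - eta <= x - M <= eta by itv_lra.
have sq : (x - M) ^+ 2 <= eta.
  have := ler_norml (x - M) eta; rewrite x1 x2 => n1.
  rewrite -real_normK ?num_real// expr2.
  apply: le_trans (_ : `|x - M| * 1 <= _); last by rewrite mulr1.
  by rewrite ler_wpM2l// (le_trans n1).
by have := ler_wpM2l c_ge0 sq; have := sqr_ge0 (x - M); itv_lra.
Qed.

Lemma pr_leM : mu `]-oo, M] = 1 / 2.
Proof. by rewrite /fprob densX// medX. Qed.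

Lemma pr_gtM : mu `]M, +oo[ = 1 / 2.
Proof.
have mA := mXS (measurable_itv `]-oo, M]); have mB := mXS (measurable_itv `]M, +oo[).
have := pr_setID P (@measurableT _ Omega) mA.
rewrite setTI pr_setT pr_leM setTD (_ : ~` _ = X @^-1` `]M, +oo[); last first.
  apply/seteqP; split=> om; rewrite /= !in_itv/= andbT ltNge; first by move/negP.
  by move=> /negP.
by move=> ?; itv_lra.
Qed.

Lemma pr_lt_monoM eta : 0 <= eta ->
  mu `]-oo, M - eta[ <= 1 / 2 <= mu `]-oo, M + eta[.
Proof.
move=> e0; have atom := density_atomless M densX.
apply/andP; split.
  rewrite -pr_leM; apply: le_pr; try exact: mXS.
  by move=> om; rewrite /= !in_itv/= => ?; itv_lra.
rewrite -pr_leM.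
(* For [eta = 0] the open half-line misses the point [M], which is null. *)
have -> : mu `]-oo, M + eta[ = mu `]-oo, M + eta[ + mu [set M].
  by rewrite [X in _ = _ + X]/fprob atom addr0.
apply: pr_le_setU; try exact: mXS.
move=> om; rewrite /= !in_itv/= le_eqVlt => /orP[/eqP|]; first by right.
by left; itv_lra.
Qed.

Lemma pr_itv_ge a b v : a <= b -> 0 <= v ->
  (forall x, a < x < b -> v <= f x) -> v * (b - a) <= mu `]a, b[.
Proof.
move=> ab v0 vf; rewrite -lee_fin -prE; last exact: mXS.
have := density_ge densX mf (measurable_itv `]a, b[) v0.
rewrite lebesgue_measure_itv/= lte_fin.
move: ab; rewrite le_eqVlt => /orP[/eqP ->|ab].
  by rewrite ltxx subrr mulr0 => _; exact: measure_ge0.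
by rewrite ab -EFinB -EFinM; apply => x /=; rewrite in_itv; exact: vf.
Qed.

Lemma pr_itv_le a b v : a <= b -> 0 <= v ->
  (forall x, a <= x <= b -> f x <= v) -> mu `[a, b] <= v * (b - a).
Proof.
move=> ab v0 vf; rewrite -lee_fin -prE; last exact: mXS.
have := density_le densX mf (measurable_itv `[a, b]) f_ge0.
rewrite lebesgue_measure_itv/= lte_fin => /(_ v) H.
move: ab; rewrite le_eqVlt => /orP[/eqP ab|ab].
  apply: le_trans (H _) _; first by move=> x /=; rewrite in_itv; exact: vf.
  by rewrite ab ltxx mule0 subrr mulr0.
apply: le_trans (H _) _; first by move=> x /=; rewrite in_itv; exact: vf.
by rewrite ab -EFinB -EFinM.
Qed.

(** Supplies the far left and far right positions of the shift argument, with probabilities [pA] and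
    [pB] bounded below. *)
Lemma pr_tails_ge : exists2 eta : R, (0 < eta) &
  (1 / 4 <= mu `]-oo, M - eta[) /\ (1 / 4 <= mu `]M + eta, +oo[).
Proof.
have fM0 := fM_gt0; have [eta0 eta0_gt0 fclose] := density_close fM0.
(* The density is at most [2 * f M] here, so a strip of this width on either side of [M] takes at
   most 1/4 of the available 1/2. *)
pose eta := Num.min eta0 (1 / (8 * f M)).
have eta_gt0 : 0 < eta by rewrite lt_min eta0_gt0 divr_gt0// mulr_gt0.
have e1 : eta <= eta0 by rewrite ge_min lexx.
have e2 : eta * (8 * f M) <= 1 by rewrite -ler_pdivlMr ?mulr_gt0// ge_min lexx orbT.
have f2 x : M - eta <= x <= M + eta -> f x <= 2 * f M.
  move=> xM; have : `|f x - f M| <= f M by apply: fclose; itv_lra.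
  by rewrite ler_norml; itv_lra.
have f0 : 0 <= 2 * f M by itv_lra.
exists eta => //; split.
  have h : mu `[M - eta, M] <= 2 * f M * (M - (M - eta)).
    by apply: pr_itv_le => //; [itv_lra|move=> x xM; apply: f2; itv_lra].
  have : mu `]-oo, M] <= mu `]-oo, M - eta[ + mu `[M - eta, M].
    apply: pr_le_setU; try exact: mXS.
    move=> om; rewrite /= !in_itv/= => XM.
    by have [|] := ltP (X om) (M - eta); [left|right; apply/andP].
  by rewrite pr_leM; itv_lra.
have h : mu `[M, M + eta] <= 2 * f M * (M + eta - M).
  by apply: pr_itv_le => //; [itv_lra|move=> x xM; apply: f2; itv_lra].
have : mu `]M, +oo[ <= mu `]M + eta, +oo[ + mu `[M, M + eta].
  apply: pr_le_setU; try exact: mXS.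
  move=> om; rewrite /= !in_itv/= !andbT => XM.
  have [|] := ltP (M + eta) (X om); [left|right] => //.
  by rewrite (ltW XM).
by rewrite pr_gtM; itv_lra.
Qed.

(** Near [M] the density is at least [f M / 2], so the distribution function leaves the value 1/2 at
    a positive rate. This separates the mean mass at [M - eta] and at [M + eta] from the quota. *)
Lemma pr_gap eta : 0 < eta -> exists2 gamma : R, 0 < gamma &
  mu `]-oo, M - eta[ <= 1 / 2 - gamma /\ 1 / 2 + gamma <= mu `]-oo, M + eta[.
Proof.
have fM0 := fM_gt0; move=> eta_gt0; have fM2 : 0 < f M / 2 by itv_lra.
have [eta0 eta0_gt0 fclose] := density_close fM2.
pose h := Num.min eta0 eta.
have h_gt0 : 0 < h by rewrite lt_min eta0_gt0.
have h1 : h <= eta0 by rewrite ge_min lexx.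
have h2 : h <= eta by rewrite ge_min lexx orbT.
have f2 x : M - h <= x <= M + h -> f M / 2 <= f x.
  move=> xM; have : `|f x - f M| <= f M / 2 by apply: fclose; itv_lra.
  by rewrite ler_norml; itv_lra.
have pr_add S T U : measurable S -> measurable T -> measurable U ->
    S `&` T `<=` set0 -> S `|` T `<=` U -> mu S + mu T <= mu U.
  move=> mS mT mU ST STU.
  rewrite (pr_setID P (mXS mU) (mXS mS)); apply: lerD; apply: le_pr;
    try exact: mXS.
  - by apply: measurableI; exact: mXS.
  - by move=> om Som; split=> //; apply: STU; left.
  - by apply: measurableD; exact: mXS.
  - move=> om Tom; split; first by apply: STU; right.
    by move=> Som; apply: (ST (X om)).
exists (f M / 2 * h); first exact: mulr_gt0.
split.
  have g : f M / 2 * (M - (M - h)) <= mu `]M - h, M[.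
    by apply: pr_itv_ge; [itv_lra|itv_lra|move=> x xM; apply: f2; itv_lra].
  have : mu `]-oo, M - eta[ + mu `]M - h, M[ <= mu `]-oo, M].
    apply: pr_add => // x /=; rewrite !in_itv/=; first by move=> []; itv_lra.
    by move=> [|]; itv_lra.
  by rewrite pr_leM; itv_lra.
have g : f M / 2 * (M + h - M) <= mu `]M, M + h[.
  by apply: pr_itv_ge; [itv_lra|itv_lra|move=> x xM; apply: f2; itv_lra].
have : mu `]-oo, M] + mu `]M, M + h[ <= mu `]-oo, M + eta[.
  apply: pr_add => // x /=; rewrite !in_itv/=; first by move=> []; itv_lra.
  by move=> [|]; itv_lra.
by rewrite pr_leM; itv_lra.
Qed.

End near_median.

Lemma eventually_le_natmul (R : realType) (x v : R) : 0 < v ->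
  exists N : nat, forall m, (N <= m)%N -> x <= v * m%:R.
Proof.
move=> v0; exists (Num.bound (`|x| / v)) => m Nm.
have h := archi_boundP (divr_ge0 (normr_ge0 x) (ltW v0)).
rewrite (le_trans (ler_norm x))// mulrC -ler_pdivrMr// ltW//.
by rewrite (lt_le_trans h)// ler_nat.
Qed.

(** * Growing assemblies *)

Section asymptotics.
Context (R : realType) (d : measure_display) (Omega : measurableType d)
  (P : probability Omega R) (r : nat) (tau : nat -> 'I_r)
  (wT : 'I_r -> R) (f : 'I_r -> R -> R) (lam : nat -> {RV P >-> R}) (M : R).
Hypothesis hw : forall theta, 0 <= wT theta.
Hypothesis hf_meas : forall theta, measurable_fun setT (f theta).
Hypothesis hf_ge0 : forall theta x, 0 <= f theta x.
Hypothesis hindep : mutually_independent lam.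
Hypothesis hdens : forall j, has_density (lam j) (f (tau j)).
Variables (beta : R) (m0 : nat).
Hypothesis beta_gt0 : 0 < beta.
Hypothesis hshare : forall theta m, (m0 <= m)%N ->
  beta * m%:R <= #|[set k : 'I_m | tau k == theta]%SET|%:R.
Hypothesis hmed : forall theta,
  (\int[lebesgue_measure]_(x in `]-oo, M]) (f theta x)%:E)%E = (1 / 2)%:E.
Hypothesis hfM : forall theta, 0 < f theta M.
Variables (eps1 c : R).
Hypothesis eps1_gt0 : 0 < eps1.
Hypothesis c_ge0 : 0 <= c.
Hypothesis hloc : forall theta x, M - eps1 <= x <= M + eps1 ->
  `|f theta x - f theta M| <= c * (x - M) ^+ 2.

Let w k := wT (tau k).
Let q m := (\sum_(k < m) w k) / 2.
Local Notation G := (left_cdf lam w).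
(** The pivot probability at quota [t], written with the distribution function of [V_i] so that
    shifts by [w i] telescope. *)
Let Piv m i t := G m i t - G m i (t - w i).
Local Notation pr := (fprob P).
Local Notation X m := (@first_lam _ _ _ _ lam m).
Local Notation wm m := (@first_wt _ w m).
Local Notation total m y om := (mass (wm m) finset.set0 (fun k => X m k om) y).
Local Notation card m theta := #|[set k : 'I_m | tau k == theta]%SET|.

Let w_ge0 k : 0 <= w k. Proof. exact: hw. Qed.
Let wm_ge0 m (k : 'I_m) : 0 <= wm m k. Proof. exact: hw. Qed.
Let X_indep m : indep_family (X m). Proof. exact: first_lam_indep. Qed.
Let atomless k y : P (lam k @^-1` [set y]) = 0%E.
Proof. exact: density_atomless (hdens k). Qed.
Let X_atomless m (k : 'I_m) y : P (X m k @^-1` [set y]) = 0%E.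
Proof. exact: atomless. Qed.

Let same_law i j S : tau i = tau j -> measurable S ->
  P (lam i @^-1` S) = P (lam j @^-1` S).
Proof. by move=> ij mS; rewrite !hdens// ij. Qed.

Let left_cdf_exch m i j t : (i < m)%N -> (j < m)%N -> tau i = tau j ->
  G m i t = G m j t.
Proof.
move=> im jm ij.
rewrite (left_cdfE _ _ (Ordinal im)) (left_cdfE _ _ (Ordinal jm)).
apply: cdf_lmass_exch => //; first by rewrite /first_wt /w /= ij.
by move=> A mA; exact: same_law.
Qed.

Let left_cdf_mono m i s t : (i < m)%N -> s <= t -> G m i s <= G m i t.
Proof.
move=> im st; rewrite !(left_cdfE _ _ (Ordinal im)) -subr_ge0.
by rewrite -pr_itv_lmass// pr_ge0.
Qed.

Let Piv_ge0 m i t : (i < m)%N -> 0 <= Piv m i t.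
Proof.
by move=> im; rewrite subr_ge0; apply: left_cdf_mono => //; rewrite lerBlDr lerDl.
Qed.

Let Piv_exch m i j t : (i < m)%N -> (j < m)%N -> tau i = tau j ->
  Piv m i t = Piv m j t.
Proof.
by move=> im jm ij; rewrite /Piv !(@left_cdf_exch m i j)// /w ij.
Qed.

Let pr_pivE m (i : 'I_m) t : pr (piv (wm m) (X m) i t) = Piv m i t.
Proof. by rewrite pr_piv// /Piv !left_cdfE. Qed.

Let card_Piv m i t : (i < m)%N ->
  (card m (tau i))%:R * Piv m i t =
  pr (class_piv (wm m) (X m) [set k : 'I_m | tau k == tau i]%SET t).
Proof.
move=> im; rewrite pr_class_piv// mulr_natl -sumr_const.
apply: eq_bigr => k; rewrite inE => /eqP ki.
by rewrite pr_pivE; exact: Piv_exch.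
Qed.

(** At least [beta * m] members of the type of [i] share this probability, and their pivot events
    are disjoint off ties. The bound is uniform in the quota [t]. *)
Let Piv_le m i t : (m0 <= m)%N -> (i < m)%N -> m%:R * Piv m i t <= beta^-1.
Proof.
move=> m0m im; rewrite -[leRHS]mul1r ler_pdivlMr// mulrC mulrA.
apply: le_trans (_ : (card m (tau i))%:R * Piv m i t <= _).
  by rewrite ler_wpM2r ?Piv_ge0// hshare.
rewrite card_Piv//; apply: pr_le1; exact: measurable_class_piv.
Qed.

Let sum_Piv_ge1 m : 0 < q m -> 1 <= \sum_(i < m) Piv m i (q m).
Proof.
move=> q0; under eq_bigr do rewrite -pr_pivE.
have W0 : 0 < \sum_(k < m) w k by move: q0; rewrite /q; lra.
apply: sum_pr_piv_ge1 => //; apply/andP; split; first exact: ltW.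
by rewrite /q /first_wt; lra.
Qed.

Let wmax := \sum_theta wT theta.

Let w_le k : w k <= wmax.
Proof. by rewrite /wmax (bigD1 (tau k))//= lerDl; exact: sumr_ge0. Qed.

Let sum_sqr_le m : \sum_k (wm m k) ^+ 2 <= m%:R * wmax ^+ 2.
Proof.
rewrite mulr_natl -[Y in _ *+ Y]card_ord -sumr_const; apply: ler_sum => k _.
by rewrite ler_sqr ?nnegrE//; [exact: w_le|exact: le_trans (w_ge0 0%N) (w_le 0%N)].
Qed.

Let sum_indicator m theta (v : R) :
  \sum_(k < m) (if tau k == theta then v else 0) = (card m theta)%:R * v.
Proof.
rewrite -big_mkcond mulr_natl -sumr_const.
by apply: eq_bigl => k; rewrite inE.
Qed.

Let sum_half m : \sum_(k < m) w k / 2 = q m.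
Proof. by rewrite /q mulr_suml. Qed.

Let mass_tails j eta : 0 < w j -> 0 < eta -> exists2 C : R, 0 <= C &
  forall s, exists N : nat, forall m, (N <= m)%N ->
    m%:R * pr [set om | q m - s < total m (M - eta) om] <= C /\
    m%:R * pr [set om | total m (M + eta) om <= q m + s] <= C.
Proof.
move=> wj eta0; have eta_ge0 := ltW eta0.
have [g g0 [gl gr]] := pr_gap (hf_meas (tau j)) (hdens j)
  (hmed (tau j)) (hfM (tau j)) eps1_gt0 c_ge0 (@hloc (tau j)) eta0.
have bet0 := beta_gt0.
(* Half of the guaranteed drift of the mean per representative; the other half absorbs [s]. *)
pose v := beta * (w j * g) / 2.
have v0 : 0 < v by rewrite divr_gt0// mulr_gt0// mulr_gt0.
exists (wmax ^+ 2 / v ^+ 2); first by rewrite divr_ge0 ?sqr_ge0.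
move=> s; have [N HN] := eventually_le_natmul `|s| v0.
exists (maxn N (maxn m0 1)) => m; rewrite !geq_max => /and3P[Nm m0m m1].
have mpos : 0 < m%:R :> R by rewrite ltr0n.
have sm : `|s| <= v * m%:R by exact: HN.
have s1 := ler_norm s.
have vm0 : 0 < v * m%:R by exact: mulr_gt0.
have card_ge : 2 * (v * m%:R) <= (card m (tau j))%:R * (w j * g).
  have := ler_wpM2r (ltW (mulr_gt0 wj g0)) (hshare (tau j) m0m).
  by rewrite /v; lra.
have mono k := pr_lt_monoM (hdens k) (hmed (tau k)) eta_ge0.
have boundC p : p <= (\sum_k (wm m k) ^+ 2) / (v * m%:R) ^+ 2 ->
    m%:R * p <= wmax ^+ 2 / v ^+ 2.
  move=> hp; have h := le_trans hp (ler_wpM2r _ (sum_sqr_le m)).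
  have := ler_wpM2l (ltW mpos) (h _ : p <= _); rewrite invr_ge0 sqr_ge0 => /(_ isT).
  move/le_trans; apply; rewrite le_eqVlt; apply/orP; left; apply/eqP.
  by field; rewrite !lt0r_neq0.
have same k S : tau k = tau j -> measurable S ->
    pr (lam k @^-1` S) = pr (lam j @^-1` S).
  by move=> kj mS; rewrite /fprob (same_law kj).
split; apply: boundC.
  apply: pr_mass_gt => //.
  have : \sum_k wm m k * pr (X m k @^-1` `]-oo, M - eta[) <=
      \sum_(k < m) (w k / 2 - if tau k == tau j then w j * g else 0).
    apply: ler_sum => k _; rewrite /first_wt /first_lam; have /andP[h _] := mono k.
    have := ler_wpM2l (w_ge0 k) h; case: eqP => [kj|_]; last by lra.
    have -> : w k = w j by rewrite /w kj.
    rewrite (same _ _ kj)// => _.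
    by have := ler_wpM2l (w_ge0 j) gl; lra.
  by rewrite sumrB sum_half sum_indicator; lra.
apply: pr_mass_le => //.
have : \sum_(k < m) (w k / 2 + if tau k == tau j then w j * g else 0) <=
    \sum_k wm m k * pr (X m k @^-1` `]-oo, M + eta[).
  apply: ler_sum => k _; rewrite /first_wt /first_lam; have /andP[_ h] := mono k.
  have := ler_wpM2l (w_ge0 k) h; case: eqP => [kj|_]; last by lra.
  have -> : w k = w j by rewrite /w kj.
  rewrite (same _ _ kj)// => _.
  by have := ler_wpM2l (w_ge0 j) gr; lra.
by rewrite big_split/= sum_half sum_indicator; lra.
Qed.

Let Piv_shift i s e : 0 < w i -> 0 < e -> exists N : nat, forall m, (N <= m)%N ->
  m%:R * `|Piv m i (q m + s + w i) - Piv m i (q m + s)| <= e.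
Proof.
move=> wi e0; have bet0 := beta_gt0.
have [eta eta0 [pA pB]] := pr_tails_ge (hf_meas (tau i)) (hf_ge0 (tau i)) (hdens i)
  (hmed (tau i)) (hfM (tau i)) eps1_gt0 c_ge0 (@hloc (tau i)).
have [C C0 HC] := mass_tails wi eta0.
(* Each of the two terms [(delta + delta) / p] with [p >= 1/4] is at most [8 * delta], together
   [e * beta]. The factor [beta] pays for passing from the class to one member. *)
pose delta := e * beta / 16.
have delta0 : 0 < delta by rewrite divr_gt0// mulr_gt0.
have [N1 H1] := HC (w i - s); have [N2 H2] := HC s.
have [N3 H3] := eventually_le_natmul C delta0.
have [N4 H4] := eventually_le_natmul 1 (mulr_gt0 (exprn_gt0 2 delta0) bet0).
exists (maxn N1 (maxn N2 (maxn N3 (maxn N4 (maxn m0 i.+1))))) => m.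
rewrite !geq_max => /andP[N1m /and5P[N2m N3m N4m m0m im]].
have mpos : 0 < m%:R :> R by rewrite ltr0n (leq_ltn_trans _ im).
have small p : m%:R * p <= C -> p <= delta.
  by move=> /le_trans /(_ (H3 _ N3m)); rewrite mulrC ler_pM2r.
have [/small eA _] := H1 _ N1m; have [_ /small eB] := H2 _ N2m.
pose Q := [set k : 'I_m | tau k == tau i]%SET.
have QE k : k \in Q -> tau k = tau i by rewrite inE => /eqP.
have law S k : measurable S -> k \in Q -> pr (X m k @^-1` S) = pr (lam i @^-1` S).
  by move=> mS /QE ki; rewrite /fprob (same_law ki).
have cardQ := hshare (tau i) m0m.
have Qlarge : 1 <= delta ^+ 2 * #|Q|%:R.
  apply: le_trans (H4 _ N4m) _; rewrite -mulrA ler_wpM2l ?sqr_ge0//.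
have sA : pr [set om | q m + s - w i < total m (M - eta) om] <= delta.
  by rewrite -[q m + s - w i]addrA -[s - w i]opprB.
have wQ k : k \in Q -> wm m k = w i by move=> /QE ki; rewrite /first_wt /w ki.
have lawA k (kQ : k \in Q) := law _ k (measurable_itv `]-oo, M - eta[) kQ.
have lawB k (kQ : k \in Q) := law _ k (measurable_itv `]M + eta, +oo[) kQ.
have pA0 : 0 < pr (lam i @^-1` `]-oo, M - eta[) by lra.
have pB0 : 0 < pr (lam i @^-1` `]M + eta, +oo[) by lra.
have := class_piv_shift (@wm_ge0 m) (@X_indep m) wQ lawA lawB pA0 pB0 delta0 Qlarge
    sA eB.
rewrite -!card_Piv// -mulrBr normrM ger0_norm// => h.
have inv4 p : 1 / 4 <= p -> (delta + delta) / p <= 8 * delta.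
  move=> hp; have p0 : 0 < p by lra.
  by rewrite ler_pdivrMr//; have := ler_wpM2l (ltW delta0) hp; lra.
have := inv4 _ pA; have := inv4 _ pB.
set D := `|_| in h *.
have D0 : 0 <= D by exact: normr_ge0.
have := ler_wpM2r D0 cardQ => h1 h2 h3.
rewrite -(ler_pM2l bet0) mulrA (le_trans h1)// (le_trans h)//.
by move: h2 h3; rewrite /delta; lra.
Qed.

Let Piv_shiftn i K e : 0 < w i -> 0 < e -> exists N : nat, forall m, (N <= m)%N ->
  m%:R * `|Piv m i (q m + w i *+ K) - Piv m i (q m)| <= e.
Proof.
move=> wi; elim: K e => [|K IH] e e0.
  by exists 0%N => m _; rewrite mulr0n addr0 subrr normr0 mulr0 ltW.
have e2 : 0 < e / 2 by lra.
have [N1 H1] := IH _ e2; have [N2 H2] := Piv_shift (w i *+ K) wi e2.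
exists (maxn N1 N2) => m; rewrite geq_max => /andP[/H1 h1 /H2 h2].
have mpos : 0 <= m%:R :> R by [].
rewrite mulrSr addrA.
have := ler_wpM2l mpos (ler_distD (Piv m i (q m + w i *+ K))
  (Piv m i (q m + w i *+ K + w i)) (Piv m i (q m))).
by rewrite (mulrDr m%:R); lra.
Qed.

Let Piv_average i K e : 0 < w i -> 0 < e -> exists N : nat, forall m, (N <= m)%N ->
  m%:R * `|K%:R * Piv m i (q m) - (G m i (q m + w i *+ K - w i) - G m i (q m - w
      i))| <= e.
Proof.
move=> wi; elim: K e => [|K IH] e e0.
  by exists 0%N => m _; rewrite mulr0n addr0 subrr mul0r subrr normr0 mulr0 ltW.
have e2 : 0 < e / 2 by lra.
have [N1 H1] := IH _ e2; have [N2 H2] := Piv_shiftn K wi e2.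
exists (maxn N1 N2) => m; rewrite geq_max => /andP[/H1 h1 /H2 h2].
have mpos : 0 <= m%:R :> R by [].
rewrite (mulrSr (w i)) addrA addrK.
move: h1 h2; rewrite /Piv -/(Piv m i (q m)).
set g1 := G _ _ (_ - _); set g0 := G _ _ (q m - w i); set g2 := G _ _ (_ + _).
set p := Piv _ _ _ => h1 h2.
(* The last summand [g2 - g1] is the pivot probability at quota [q m + w i *+ K], which [Piv_shiftn]
   compares with [p]. *)
have -> : K.+1%:R * p - (g2 - g0) = (K%:R * p - (g1 - g0)) - ((g2 - g1) - p).
  by rewrite -natr1; ring.
have := ler_wpM2l mpos (ler_normB (K%:R * p - (g1 - g0)) (g2 - g1 - p)).
by rewrite (mulrDr m%:R); lra.
Qed.

(* A window of fixed length is covered by boundedly many pivot events. *)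
Let window_le i a : 0 < w i -> exists2 C : R, 0 <= C & forall m t,
  (m0 <= m)%N -> (i < m)%N -> m%:R * (G m i (t + a) - G m i t) <= C.
Proof.
move=> wi; have [K HK] := eventually_le_natmul a wi.
have b0 : 0 <= beta^-1 by rewrite invr_ge0 ltW.
exists (beta^-1 *+ K); first exact: mulrn_wge0.
move=> m t m0m im; have mpos : 0 <= m%:R :> R by [].
have step k : m%:R * (G m i (t + w i *+ k) - G m i t) <= beta^-1 *+ k.
  elim: k => [|k IH]; first by rewrite !mulr0n addr0 subrr mulr0.
  have := Piv_le (t + w i *+ k.+1) m0m im; rewrite /Piv.
  rewrite !mulrSr addrA addrK => h; move: IH h.
  by rewrite !mulrBr; lra.
apply: le_trans (step K); rewrite ler_wpM2l// lerB//.
apply: left_cdf_mono => //; rewrite lerD2l -mulr_natr; exact: HK.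
Qed.

(** With [K] the integer part of [L / w i], three errors arise, all bounded independently of [L]: 1
    from [Piv_average], [beta^-1] from the fractional part, and [C1] for each window end, which
    moves by at most [2 * w i]. *)
Let Piv_window i : 0 < w i -> exists2 C : R, 0 <= C & forall L, 0 <= L ->
  exists N : nat, forall m, (N <= m)%N ->
    `|m%:R * (L / w i) * Piv m i (q m) - m%:R * (G m i (q m + L) - G m i (q m))| <= C.
Proof.
move=> wi; have bet0 : 0 < beta^-1 by rewrite invr_gt0.
have [C1 C10 H1] := window_le (w i *+ 2) wi.
exists (1 + beta^-1 + 2 * C1); first by rewrite addr_ge0 ?mulr_ge0// addr_ge0// ltW.
move=> L L0; have Lw0 : 0 <= L / w i by rewrite divr_ge0// ltW.
pose K := Num.truncn (L / w i).
have /andP[KL LK] := truncn_itv Lw0; rewrite -/K in KL LK.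
have {}KL : w i *+ K <= L by rewrite -mulr_natl -ler_pdivlMr.
have LK' := LK; have {}LK : L < w i *+ K + w i by rewrite -mulrSr -mulr_natl
    -ltr_pdivrMr.
have [N HN] := Piv_average K wi ltr01.
exists (maxn N (maxn m0 i.+1)) => m; rewrite !geq_max => /and3P[/HN h m0m im].
have mpos : 0 <= m%:R :> R by [].
have p1 := Piv_le (q m) m0m im; have p0 := Piv_ge0 (q m) im.
have r1 : 0 <= L / w i - K%:R.
  by rewrite subr_ge0 ler_pdivlMr// mulr_natl.
have r2 : L / w i - K%:R <= 1 by rewrite lerBlDr addrC natr1 ltW.
have a0 : 0 <= m%:R * Piv m i (q m) by exact: mulr_ge0.
have e1 : 0 <= (L / w i - K%:R) * (m%:R * Piv m i (q m)) by exact: mulr_ge0.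
have e2 : (L / w i - K%:R) * (m%:R * Piv m i (q m)) <= m%:R * Piv m i (q m).
  by rewrite -[leRHS]mul1r ler_wpM2r.
have mono s t : s <= t -> m%:R * G m i s <= m%:R * G m i t.
  by move=> st; rewrite ler_wpM2l// left_cdf_mono.
have f1 : m%:R * G m i (q m + w i *+ K - w i) <= m%:R * G m i (q m + L).
  by apply: mono; lra.
have f2 : m%:R * G m i (q m + L - w i *+ 2) <= m%:R * G m i (q m + w i *+ K - w i).
  by apply: mono; rewrite mulr2n; lra.
have f3 := H1 m (q m + L - w i *+ 2) m0m im.
rewrite subrK in f3.
have f4 : m%:R * G m i (q m - w i) <= m%:R * G m i (q m) by apply: mono; lra.
have f5 : m%:R * G m i (q m - w i *+ 2) <= m%:R * G m i (q m - w i).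
  by apply: mono; rewrite mulr2n; lra.
have f6 := H1 m (q m - w i *+ 2) m0m im.
rewrite subrK in f6.
rewrite -[Y in Y * _ <= _](ger0_norm mpos) -normrM in h.
move: h; rewrite !ler_norml => /andP[h1 h2].
have E : m%:R * (L / w i) * Piv m i (q m) =
  (L / w i - K%:R) * (m%:R * Piv m i (q m)) + m%:R * (K%:R * Piv m i (q m)) by ring.
move: (Piv m i (q m)) E h1 h2 f3 f6 e1 e2 p1 => p E.
rewrite E !mulrBr => h1 h2 f3 f6 e1 e2 p1.
by apply/andP; split; lra.
Qed.

Let window_compare i j kappa : i != j -> 0 < w i -> 0 < w j -> 0 <= kappa ->
  f (tau i) M < kappa * f (tau j) M -> exists2 C : R, 0 <= C &
  forall L, 0 <= L -> exists N : nat, forall m, (N <= m)%N ->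
    m%:R * (G m i (q m + L) - G m i (q m)) <=
    kappa * (m%:R * (G m j (q m + L) - G m j (q m))) + C.
Proof.
move=> ij wi wj k0 fk.
have k1 : 0 < 1 + kappa by lra.
(* The solution of [f (tau i) M + v = kappa * (f (tau j) M - v)]: densities within [v] of their
   values at [M] still satisfy the domination. *)
pose v := (kappa * f (tau j) M - f (tau i) M) / (1 + kappa).
have v0 : 0 < v by rewrite divr_gt0// subr_gt0.
have vE : v * (1 + kappa) = kappa * f (tau j) M - f (tau i) M.
  by rewrite /v divfK// gt_eqF.
have [eta1 eta10 close_i] := density_close eps1_gt0 c_ge0 (@hloc (tau i)) v0.
have [eta2 eta20 close_j] := density_close eps1_gt0 c_ge0 (@hloc (tau j)) v0.
pose eta := Num.min eta1 eta2.
have eta0 : 0 < eta by rewrite lt_min eta10.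
have le1 : eta <= eta1 by rewrite ge_min lexx.
have le2 : eta <= eta2 by rewrite ge_min lexx orbT.
have dom S : measurable S -> S `<=` `[M - eta, M + eta] ->
    (P (lam i @^-1` S) <= kappa%:E * P (lam j @^-1` S))%E.
  move=> mS SJ; apply: (density_compare (hdens i) (hdens j)) => //.
  move=> x /SJ; rewrite /= in_itv/= => /andP[x1 x2].
  have /close_i : M - eta1 <= x <= M + eta1 by apply/andP; split; lra.
  have /close_j : M - eta2 <= x <= M + eta2 by apply/andP; split; lra.
  rewrite !ler_norml => /andP[j1 _] /andP[_ i2].
  by have := ler_wpM2l k0 j1; lra.
have [C1 C10 H1] := mass_tails wj eta0.
have [C2 C20 H2] := window_le (w j) wi.
have [C3 C30 H3] := window_le (w i) wj.
exists (kappa * C3 + C2 + C1 + C1).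
  by rewrite !addr_ge0// mulr_ge0.
(* The tails for the quotas [q] and [q + L] share the constant [C1]; only the threshold [N2] depends
   on [L]. *)
move=> L L0; have [N1 HN1] := H1 0; have [N2 HN2] := H1 L.
exists (maxn N1 (maxn N2 (maxn m0 (maxn i.+1 j.+1)))) => m.
rewrite !geq_max => /and5P[/HN1[tA _] /HN2[_ tB] m0m im jm].
rewrite subr0 in tA.
have mpos : 0 <= m%:R :> R by [].
have ijm : Ordinal im != Ordinal jm by rewrite -val_eqE.
have := lmass_window_compare (@wm_ge0 m) (@X_indep m) (q m) L ijm k0 dom.
rewrite !pr_itv_lmass// ?lerDl// -!left_cdfE/= => h.
have := ler_wpM2l mpos h.
have h2 := H2 m (q m) m0m im; have h3 := ler_wpM2l k0 (H3 m (q m + L) m0m jm).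
move: h2 h3; rewrite /first_wt.
set pa := pr [set om | q m < _] in tA *; set pb := pr [set om | _ <= _] in tB *.
by rewrite !mulrDr; lra.
Qed.

Let Piv_compare i j kappa e : i != j -> 0 < w i -> 0 < w j -> 0 <= kappa ->
  f (tau i) M < kappa * f (tau j) M -> 0 < e ->
  exists N : nat, forall m, (N <= m)%N ->
    m%:R * Piv m i (q m) / w i <= kappa * (m%:R * Piv m j (q m) / w j) + e.
Proof.
move=> ij wi wj k0 fk e0.
have [C C0 H] := window_compare ij wi wj k0 fk.
have [Ci Ci0 Hi] := Piv_window wi; have [Cj Cj0 Hj] := Piv_window wj.
have kC : 0 <= kappa * Cj by exact: mulr_ge0.
(* All constants are fixed before [L], so dividing by a large [L] brings their sum below [e]. The
   summand 1 keeps [L] positive. *)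
pose L := (C + Ci + kappa * Cj) / e + 1.
have L0 : 0 < L by rewrite ltr_wpDl// divr_ge0 ?(ltW e0)// !addr_ge0.
have Le : C + Ci + kappa * Cj <= L * e.
  by rewrite /L mulrDl mul1r divfK ?gt_eqF//; lra.
have [N1 H1] := H _ (ltW L0); have [N2 H2] := Hi _ (ltW L0).
have [N3 H3] := Hj _ (ltW L0).
exists (maxn N1 (maxn N2 N3)) => m; rewrite !geq_max => /and3P[/H1 h1 /H2 h2 /H3 h3].
rewrite -(ler_pM2l L0) (mulrDr L).
move: h2 h3; rewrite !ler_norml => /andP[_ h2] /andP[h3 _].
have := ler_wpM2l k0 h3; move: h2.
have E k : m%:R * (L / w k) * Piv m k (q m) = L * (m%:R * Piv m k (q m) / w k).
  by ring.
by move: h1; rewrite !E; lra.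
Qed.

(* The theorem says that [scaled m i] is asymptotically independent of [i]. *)
Let scaled m i := m%:R * Piv m i (q m) / (w i * f (tau i) M).

Let scaled_compare i j e : 0 < w i -> 0 < w j -> 0 < e ->
  exists N : nat, forall m, (N <= m)%N -> scaled m i <= scaled m j + e.
Proof.
move=> wi wj e0; have bet0 := beta_gt0.
have fi := hfM (tau i); have fj := hfM (tau j).
have [<-|ij] := eqVneq i j; first by exists 0%N => m _; rewrite lerDl ltW.
(* The excess of [kappa] over the density ratio. By [Piv_le] it contributes at most [e / 2] after
   division by [f (tau i) M]; [Piv_compare] contributes the other half. *)
pose t := e / 2 * (f (tau i) M * beta * w j).
have t0 : 0 < t by rewrite !mulr_gt0.
pose kappa := f (tau i) M / f (tau j) M + t.
have k0 : 0 <= kappa by rewrite addr_ge0 ?(ltW t0)// divr_ge0// ltW.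
have fk : f (tau i) M < kappa * f (tau j) M.
  by rewrite mulrDl divfK ?gt_eqF// ltrDl mulr_gt0.
have e1 : 0 < e / 2 * f (tau i) M by rewrite !mulr_gt0.
have [N HN] := Piv_compare ij wi wj k0 fk e1.
exists (maxn N (maxn m0 j.+1)) => m; rewrite !geq_max => /and3P[/HN h m0m jm].
have pj := Piv_le (q m) m0m jm.
rewrite -(ler_pM2r fi).
have -> : scaled m i * f (tau i) M = m%:R * Piv m i (q m) / w i.
  by rewrite /scaled; field; rewrite !gt_eqF.
apply: le_trans h _.
have -> : kappa * (m%:R * Piv m j (q m) / w j) =
    scaled m j * f (tau i) M + e / 2 * f (tau i) M * (beta * (m%:R * Piv m j (q m))).
  by rewrite /scaled /kappa /t; field; rewrite !gt_eqF.
have h : beta * (m%:R * Piv m j (q m)) <= 1.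
  by have := ler_wpM2l (ltW bet0) pj; rewrite divff ?gt_eqF.
have := ler_wpM2l (ltW e1) h; rewrite (mulrDl (scaled m j)).
by move: (beta * _) (scaled m j * _) => u v; lra.
Qed.

Let rep_exists theta : exists k, tau k = theta.
Proof.
have := hshare theta (leqnSn m0).
have : 0 < beta * m0.+1%:R by rewrite mulr_gt0.
move=> h /(lt_le_trans h); rewrite ltr0n card_gt0 => /set0Pn[k].
by rewrite inE => /eqP ?; exists k.
Qed.

(** By comparison every [m * pi_k] is at most [(scaled m j + e) * B0]. Since the [pi_k] sum to at
    least 1, [scaled m j + e >= 1 / B0 = 2 * e]. The comparison must be uniform in [k];
    exchangeability reduces it to one index [rep theta] for each of the finitely many types. *)
Let scaled_low j : 0 < w j -> exists2 B : R, 0 < B &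
  exists N : nat, forall m, (N <= m)%N -> B <= scaled m j.
Proof.
move=> wj.
pose B0 := \sum_theta wT theta * f theta M.
have term_ge0 theta : 0 <= wT theta * f theta M by rewrite mulr_ge0// ltW.
have term_le k : w k * f (tau k) M <= B0.
  by rewrite /B0 (bigD1 (tau k))//= lerDl; exact: sumr_ge0.
have B00 : 0 < B0 by apply: lt_le_trans (term_le j); rewrite mulr_gt0.
pose e := (2 * B0)^-1.
have e0 : 0 < e by rewrite invr_gt0 mulr_gt0.
have eB : e * B0 = 1 / 2 by rewrite /e; field; rewrite gt_eqF.
have [rep repE] := choice rep_exists.
have ev theta : exists N : nat, forall m, (N <= m)%N -> 0 < w (rep theta) ->
    scaled m (rep theta) <= scaled m j + e.
  have [wr|wr] := ltP 0 (w (rep theta)); last first.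
    by exists 0%N.
  by have [N HN] := scaled_compare wr wj e0; exists N => m /HN h _.
have [Nf HNf] := choice ev.
exists e => //.
exists (maxn j.+1 (\max_theta maxn (Nf theta) (rep theta).+1)) => m.
rewrite geq_max => /andP[jm /bigmax_leqP Hm].
have mpos : 0 < m%:R :> R by rewrite ltr0n (leq_ltn_trans _ jm).
have q0 : 0 < q m.
  rewrite divr_gt0// (bigD1 (Ordinal jm))//= ltr_wpDr//.
  exact: sumr_ge0.
have sj0 : 0 <= scaled m j.
  by rewrite divr_ge0 ?mulr_ge0 ?Piv_ge0// ltW// mulr_gt0.
have bound (k : 'I_m) : m%:R * Piv m k (q m) <= (scaled m j + e) * B0.
  have s0 : 0 <= scaled m j + e by rewrite addr_ge0// ltW.
  have := w_ge0 k; rewrite le_eqVlt => /orP[/eqP wk|wk].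
    by rewrite /Piv -wk subr0 subrr mulr0 mulr_ge0// ltW.
  have := Hm (tau k) isT; rewrite geq_max => /andP[Nm rm].
  have wr : w (rep (tau k)) = w k by rewrite /w repE.
  have := HNf (tau k) m Nm; rewrite wr => /(_ wk).
  have -> : scaled m (rep (tau k)) = m%:R * Piv m k (q m) / (w k * f (tau k) M).
    by rewrite /scaled (@Piv_exch m _ k)// wr repE.
  have wf : 0 < w k * f (tau k) M by rewrite mulr_gt0.
  rewrite ler_pdivrMr// => /le_trans; apply.
  by rewrite ler_wpM2l.
have : m%:R * 1 <= \sum_(k < m) (scaled m j + e) * B0.
  apply: le_trans (ler_wpM2l (ltW mpos) (sum_Piv_ge1 q0)) _.
  by rewrite mulr_sumr; exact: ler_sum.
rewrite sumr_const card_ord -[leRHS]mulr_natl ler_pM2l// => h.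
by rewrite -(ler_pM2r B00); move: h; rewrite mulrDl eB; lra.
Qed.

Lemma pivot_ratio_cvg i j : 0 < w j ->
  (fun m => pivot_prob lam w m i / pivot_prob lam w m j) @ \oo -->
  (w i * f (tau i) M) / (w j * f (tau j) M).
Proof.
move=> wj; have fj := hfM (tau j); have fi := hfM (tau i).
have wfj : 0 < w j * f (tau j) M by rewrite mulr_gt0.
have PE m k : (k < m)%N -> pivot_prob lam w m k = Piv m k (q m).
  by move=> km; rewrite pivot_probE.
(* A zero weight is treated apart, since [scaled] divides by [w i]; the pivot probability is then
   0. *)
have := w_ge0 i; rewrite le_eqVlt => /orP[/eqP wi|wi].
  rewrite -wi !mul0r; apply/cvgrPdist_le => e e0.
  exists i.+1 => // m /= im.
  by rewrite PE// /Piv -wi subr0 subrr mul0r subrr normr0 ltW.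
have wfi : 0 < w i * f (tau i) M by rewrite mulr_gt0.
set rho := _ / _; have rho0 : 0 < rho by rewrite divr_gt0.
have [B B0 [N0 H0]] := scaled_low wj.
apply/cvgrPdist_le => e e0.
(* The error of the ratio is [rho / scaled m j] times the difference of the scaled values, and
   [scaled m j >= B]. *)
pose e1 := e * B / rho; have e10 : 0 < e1 by rewrite divr_gt0// mulr_gt0.
have [N1 H1] := scaled_compare wi wj e10.
have [N2 H2] := scaled_compare wj wi e10.
exists (maxn N0 (maxn N1 (maxn N2 (maxn i.+1 j.+1)))) => // m /=.
rewrite !geq_max => /and5P[/H0 h0 /H1 h1 /H2 h2 im jm].
have mpos : 0 < m%:R :> R by rewrite ltr0n (leq_ltn_trans _ jm).
have sj : 0 < scaled m j by exact: lt_le_trans h0.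
rewrite !PE//.
have PivE k : 0 < w k * f (tau k) M ->
    Piv m k (q m) = scaled m k * (w k * f (tau k) M) / m%:R.
  by move=> wfk; rewrite /scaled divfK ?gt_eqF// mulrAC divff ?mul1r// gt_eqF.
have -> : rho - Piv m i (q m) / Piv m j (q m) =
    rho / scaled m j * (scaled m j - scaled m i).
  rewrite !PivE// /rho; move: (scaled m j) (scaled m i) sj => u v u0.
  by field; rewrite !gt_eqF.
rewrite normrM (gtr0_norm (divr_gt0 rho0 sj)).
have hd : `|scaled m j - scaled m i| <= e1 by rewrite ler_norml; apply/andP; split; lra.
have r0 := ltW (divr_gt0 rho0 sj).
apply: le_trans (ler_wpM2l r0 hd) _.
have -> : rho / scaled m j * e1 = e * (B / scaled m j).
  by rewrite /e1; move: (scaled m j) sj => u u0; field; rewrite !gt_eqF.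
by rewrite ler_piMr ?(ltW e0)// ler_pdivrMr// mul1r.
Qed.

End asymptotics.

Theorem theorem1 (R : realType) (d : measure_display) (Omega : measurableType d)
  (P : probability Omega R) (r : nat) (tau : nat -> 'I_r)
  (wT : 'I_r -> R) (f : 'I_r -> R -> R) (lam : nat -> {RV P >-> R}) (M : R)
  (hw : forall theta, 0 <= wT theta)
  (hf_meas : forall theta, measurable_fun setT (f theta))
  (hf_ge0 : forall theta x, 0 <= f theta x)
  (hindep : mutually_independent lam)
  (hdens : forall j, has_density (lam j) (f (tau j)))
  (hshare : exists2 beta : R, 0 < beta &
     exists m0 : nat, forall theta m, (m0 <= m)%N -> beta <= type_share tau theta m R)
  (hmed : forall theta,
     (\int[lebesgue_measure]_(x in `]-oo, M]) (f theta x)%:E)%E = (1 / 2)%:E)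
  (hfM : forall theta, 0 < f theta M)
  (hloc : exists2 eps1 : R, 0 < eps1 &
     exists2 c : R, 0 <= c &
       forall theta x, M - eps1 <= x <= M + eps1 ->
         `|f theta x - f theta M| <= c * (x - M) ^+ 2) :
  forall i j : nat, 0 < wT (tau j) ->
    (fun m => pivot_prob lam (fun k => wT (tau k)) m i /
              pivot_prob lam (fun k => wT (tau k)) m j) @ \oo -->
    (wT (tau i) * f (tau i) M) / (wT (tau j) * f (tau j) M).
Proof.
move=> i j wj.
have [beta beta_gt0 [m0 share_ge]] := hshare.
have [eps1 eps1_gt0 [c c_ge0 f_near]] := hloc.
have card_ge theta m : (m0 <= m)%N ->
    beta * m%:R <= #|[set k : 'I_m | tau k == theta]%SET|%:R.
  move=> /(share_ge theta); rewrite /type_share => h.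
  have m_gt0 : (0 : R) < m%:R.
    (* For [m = 0] the share is 0 by the convention on inverses, against [beta > 0]. *)
    rewrite lt0r ler0n andbT; apply: contraTneq h => ->.
    by rewrite invr0 mulr0 -ltNge.
  move: h; rewrite ler_pdivlMr//; congr (_ <= _%:R).
  by apply: eq_card => k; rewrite inE; apply/idP/idP; rewrite ?inE.
exact: (pivot_ratio_cvg hw hf_meas hf_ge0 hindep hdens beta_gt0 card_ge hmed hfM
  eps1_gt0 c_ge0 f_near).
Qed.
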